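(* The EV valet problem is strongly NP-hard. More precisely, the following decision problem is strongly NP-hard: given an instance of the EV valet problem and a number $K$, decide whether there exists a feasible schedule of total reward at least $K$. This remains true even when restricted to instances in which all vehicles have the same charging time ($C_i = C$ for all $i \in \mathcal{V}$), all rewards satisfy $p_{j,t} \in \{0,1\}$, and there is only a single discharging station ($n = 1$).
   Context: EV valet problem. An instance consists of a set of vehicles $\mathcal{V} = \{1,\dots,m\}$, a discrete time horizon $\mathcal{T} = \{1,2,\dots,T\}$, a set of stations $\mathcal{J} = \{1,\dots,n\}$, for each vehicle $i$ a set of availabilities $\mathcal{T}_i \subseteq \mathcal{T}$ and a charging time $C_i \in \mathbb{N}$ (nonnegative integer), and for each station $j$ and time $t$ a reward $p_{j,t} \in \mathbb{R}$. A feasible schedule is a set $S$ of triples $(i,j,t)$ with $i \in \mathcal{V}$, $j \in \mathcal{J}$, $t \in \mathcal{T}_i$ (''vehicle $i$ is discharged at station $j$ at time $t$'') such that (a) for every pair $(j,t)$ there is at most one $i$ with $(i,j,t) \in S$, and (b) for every vehicle $i$, any two distinct triples $(i,j,t),(i,j',t') \in S$ satisfy $|t - t'| > C_i$ (in particular, a vehicle is used at most once per time step and cannot be discharged again during $[t+1, t+C_i]$ after a discharge at time $t$). Its total reward is $\sum_{(i,j,t)\in S} p_{j,t}$. The goal is to find a feasible schedule of maximum total reward. Equivalently, it is the integer program: maximize $\sum_{i,j,t} p_{j,t} x_{i,j,t}$ subject to $\sum_i x_{i,j,t} \le 1$ for all $j,t$; $\sum_{j}\sum_{t' \in [t,t+C_i]}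 x_{i,j,t'} \le 1$ for all $i$ and $t \in \mathcal{T}_i$; $x_{i,j,t} = 0$ for $t \notin \mathcal{T}_i$; $x_{i,j,t} \in \{0,1\}$. *)

(* Defs.v *)
From HB Require Import structures.
From mathcomp Require Import all_boot all_order all_algebra.
Set Implicit Arguments. Unset Strict Implicit. Unset Printing Implicit Defensive.
Import Order.TTheory GRing.Theory Num.Theory.

(*   vehicles i = 0 .. m-1, stations j = 0 .. n-1, times t = 1 .. T.    *)
Record ev_instance := EVInstance {
  ev_m : nat;
  ev_T : nat;
  ev_n : nat;
  ev_avail : nat -> nat -> bool;
  ev_C : nat -> nat;
  ev_p : nat -> nat -> rat
}.

(* a schedule is a finite set of triples (i, j, t), given as a uniq seq *)
Definition triple := (nat * nat * nat)%type.
Definition tr_i (s : triple) := s.1.1.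
Definition tr_j (s : triple) := s.1.2.
Definition tr_t (s : triple) := s.2.

Definition feasible (I : ev_instance) (S : seq triple) : Prop :=
  [/\ uniq S,
      (forall s, s \in S ->
         [/\ tr_i s < ev_m I, tr_j s < ev_n I,
             1 <= tr_t s <= ev_T I & ev_avail I (tr_i s) (tr_t s)]),
      (forall s s', s \in S -> s' \in S ->
         tr_j s = tr_j s' -> tr_t s = tr_t s' -> s = s') &
      (forall s s', s \in S -> s' \in S -> s <> s' -> tr_i s = tr_i s' ->
         (tr_t s + ev_C I (tr_i s) < tr_t s') || (tr_t s' + ev_C I (tr_i s) < tr_t s))].

Definition total_reward (I : ev_instance) (S : seq triple) : rat :=
  (\sum_(s <- S) ev_p I (tr_j s) (tr_t s))%R.

Definition ev_decision (I : ev_instance) (K : rat) : Prop :=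
  exists S, feasible I S /\ (K <= total_reward I S)%R.

Definition restricted (I : ev_instance) : Prop :=
  [/\ exists C, forall i, i < ev_m I -> ev_C I i = C,
      (forall j t, j < ev_n I -> 1 <= t <= ev_T I ->
          ev_p I j t = 0%R \/ ev_p I j t = 1%R) &
      ev_n I = 1].

Inductive Sym := Zs | Os | Ss | Ts.

Definition bits (s : seq bool) : seq Sym := map (fun b => if b then Os else Zs) s.

(* data of a restricted instance: common charging time C, threshold K,
   rewards p_{1,t} (t = 1..T) and availability vectors of the vehicles *)
Record ev_data := EVData {
  d_C : nat; d_K : nat; d_p : seq bool; d_av : seq (seq bool) }.

Definition data_wf (d : ev_data) : bool :=
  all (fun a => size a == size (d_p d)) (d_av d).

Definition of_data (d : ev_data) : ev_instance :=
  {| ev_m := size (d_av d);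
     ev_T := size (d_p d);
     ev_n := 1;
     ev_avail := fun i t => nth false (nth [::] (d_av d) i) t.-1;
     ev_C := fun _ => d_C d;
     ev_p := fun _ t => ((nth false (d_p d) t.-1)%:R)%R |}.

(* numbers (C and K) are written in UNARY (strong NP-hardness) *)
Definition enc_ev (d : ev_data) : seq Sym :=
  nseq (d_C d) Os ++ [:: Ss] ++ nseq (d_K d) Os ++ [:: Ss] ++
  bits (d_p d) ++ [:: Ss] ++ flatten [seq bits a ++ [:: Ss] | a <- d_av d].

Definition EV_restricted_lang (x : seq Sym) : Prop :=
  exists d, [/\ data_wf d, enc_ev d = x, restricted (of_data d) &
                ev_decision (of_data d) ((d_K d)%:R)%R].

(*    (None = blank).                                                  *)
Inductive move := MLeft | MRight | MStay.

Record TM := MkTM {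
  tm_Q : finType;
  tm_start : tm_Q;
  tm_halt : tm_Q -> bool;
  tm_acc : tm_Q -> bool;
  tm_delta : tm_Q -> option Sym -> tm_Q * option Sym * move
}.

(* tape: reversed left part, head cell, right part (blank beyond ends) *)
Definition tape := (seq (option Sym) * option Sym * seq (option Sym))%type.

Definition move_tape (mv : move) (tp : tape) : tape :=
  let: (l, h, r) := tp in
  match mv with
  | MStay => tp
  | MLeft => match l with
             | [::] => ([::], None, h :: r)
             | a :: l' => (l', a, h :: r) end
  | MRight => match r with
              | [::] => (h :: l, None, [::])
              | a :: r' => (h :: l, a, r') end
  end.

Definition config (M : TM) := (tm_Q M * tape)%type.

Definition step (M : TM) (c : config M) : config M :=
  let: (q, (l, h, r)) := c in
  if @tm_halt M q then c else
  let: (q', w, mv) := @tm_delta M q h in (q', move_tape mv (l, w, r)).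

Definition init (M : TM) (x : seq Sym) : config M :=
  (@tm_start M, match x with
               | [::] => ([::], None, [::])
               | a :: x' => ([::], Some a, map Some x') end).

Definition run (M : TM) (k : nat) (x : seq Sym) : config M :=
  iter k (@step M) (@init M x).

Definition halted (M : TM) (c : config M) : bool := @tm_halt M c.1.
Definition accepting (M : TM) (c : config M) : bool := @tm_halt M c.1 && @tm_acc M c.1.

Fixpoint read_out (s : seq (option Sym)) : seq Sym :=
  if s is Some a :: s' then a :: read_out s' else [::].

Definition output (M : TM) (c : config M) : seq Sym :=
  let: (_, (_, h, r)) := c in read_out (h :: r).

Definition language := seq Sym -> Prop.

Definition pairing (x w : seq Sym) : seq Sym :=
  flatten [seq [:: Zs; a] | a <- x] ++ [:: Os] ++ w.

Definition poly (c e n : nat) : nat := c * n.+1 ^ e.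

Definition in_NP (L : language) : Prop :=
  exists (V : TM) (c e : nat), forall x,
    (forall w, size w <= poly c e (size x) ->
       exists k, k <= poly c e (size x) /\ halted (run V k (pairing x w))) /\
    (L x <-> exists w k, [/\ size w <= poly c e (size x),
                             k <= poly c e (size x) &
                             accepting (run V k (pairing x w))]).

Definition poly_reduces (L1 L2 : language) : Prop :=
  exists (M : TM) (c e : nat), forall x,
    exists k, [/\ k <= poly c e (size x), halted (run M k x) &
                  (L1 x <-> L2 (output (run M k x)))].

Definition NP_hard (L : language) : Prop :=
  forall L', in_NP L' -> poly_reduces L' L.

(* Main.v *)
(* The run of a verifier is described by a CNF whose clauses only propagate the first row of the
   tableau forward, forbid the non-accepting final states, and leave the choice of the witness open.
   The tape is recorded relatively to the head, so that a transition shifts a whole row.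

   A CNF becomes a scheduling instance with charging time 3B and five stretches of about B times
   each, where only the first, third and fifth give rewards and every reward must be collected.  A
   vehicle can then serve either once in the middle stretch, or once in the first and once in the
   last one.  There is a vehicle for each literal of a copy, one per clause, of each variable.  The
   middle stretch uses up one of the two literals of each copy; the first stretch encodes that the
   copies of a variable imply each other cyclically, and the last one encodes the clauses.

   The resulting table of bits is given by arithmetic expressions in its row, its column and the
   input.  Nested loops emitting symbols that depend on such expressions are compiled to programs
   on finitely many stacks, which are simulated on interleaved tracks of a single tape; running
   times stay polynomial because the values of all expressions are polynomially bounded. *)

From HB Require Import structures.
From mathcomp Require Import all_boot all_order all_algebra.
From mathcomp Require Import zify.
From Stdlib Require Import FunctionalExtensionality.
Require Import Defs.
Set Implicit Arguments. Unset Strict Implicit. Unset Printing Implicit Defensive.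
Import GRing.Theory Num.Theory.

(** * Structured programs on one tape *)

(** The tableau needs no clause saying that a cell has at most one value. A satisfying assignment
    may make several values true in a cell, but propagation makes those of a genuine run true among
    them, so the last state of that run is not a forbidden one. With the head in a fixed column, a
    transition clause has only three premises: the state, the scanned symbol and one neighbouring
    cell.

    Since every reward is demanded, each rewarded time is a disjunction over the vehicles available
    there. The obstacle is that vehicles are consumed: one literal cannot serve two clauses, hence
    one copy of each variable per clause. The copies are tied by a cycle of implications rather than
    by equivalences, because then each literal occurs in exactly one implication, and no two
    implications compete for a vehicle.

    [NP_hard] asks for an actual machine with a step bound. This is why variables and clauses are
    numbered in mixed radix, decoded by division, and why a clause index without meaning denotes a
    clause that contains every literal. *)

Inductive prog :=
| Act of (option Sym -> option Sym) & move
| Seq of prog & prog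
| Cond of (option Sym -> bool) & prog & prog
| While of (option Sym -> bool) & prog.

(** Control points. Leaving the program is the extra value [None] of [option (pt p)]; [Cond] and
    [While] have a point of their own for the test. *)
Fixpoint pt (p : prog) : finType :=
  match p with
  | Act _ _ => unit
  | Seq a b => (pt a + pt b)%type
  | Cond _ a b => option (pt a + pt b)
  | While _ a => option (pt a)
  end.

Fixpoint entry (p : prog) : pt p :=
  match p with
  | Act _ _ => tt
  | Seq a b => inl (entry a)
  | Cond _ a b => None
  | While _ a => None
  end.

Definition mapq (Q Q' : Type) (h : Q -> Q') (r : Q * option Sym * move) :=
  let: (q, w, mv) := r in (h q, w, mv).

Fixpoint pdelta (p : prog) : pt p -> option Sym -> option (pt p) * option Sym * move :=
  match p with
  | Act g mv => fun _ s => (None, g s, mv)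
  | Seq a b => fun q s =>
      match q with
      | inl q => mapq (fun q' => Some (if q' is Some q1 then inl q1 else inr (entry b)))
                      (pdelta q s)
      | inr q => mapq (omap inr) (pdelta q s)
      end
  | Cond t a b => fun q s =>
      match q with
      | None => (Some (Some (if t s then inl (entry a) else inr (entry b))), s, MStay)
      | Some (inl q) => mapq (omap (fun q' => Some (inl q'))) (pdelta q s)
      | Some (inr q) => mapq (omap (fun q' => Some (inr q'))) (pdelta q s)
      end
  | While t a => fun q s =>
      match q with
      | None => (if t s then Some (Some (entry a)) else None, s, MStay)
      (* Leaving the body yields [None], which [Some] turns into the control point of the test: this
         is the back edge of the loop. *)
      | Some q => mapq Some (pdelta q s)
      end
  end.

Definition mach (p : prog) : TM :=
  @MkTM (option (pt p)) (Some (entry p)) (fun q => ~~ isSome q) (fun _ => true)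
    (fun q s => if q is Some q then pdelta q s else (None, s, MStay)).

(** * Terminating runs on tapes indexed by the integers *)

Definition ftape := int -> option Sym.

Definition fset (f : ftape) (z : int) (a : option Sym) : ftape :=
  fun y => if y == z then a else f y.

Definition dmv (mv : move) : int :=
  match mv with MLeft => -1 | MRight => 1 | MStay => 0 end%R.

Lemma fset_id f z : fset f z (f z) = f.
Proof. by apply: functional_extensionality => y; rewrite /fset; case: eqP => [->|]. Qed.

Section Termination.
Variables (Q : Type) (delta : Q -> option Sym -> option Q * option Sym * move).

Inductive term : Q -> int -> ftape -> int -> ftape -> nat -> Prop :=
| term_halt q z f w mv :
    delta q (f z) = (None, w, mv) -> term q z f (z + dmv mv)%R (fset f z w) 1
| term_next q z f w mv q1 z' f' n :
    delta q (f z) = (Some q1, w, mv) ->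
    term q1 (z + dmv mv)%R (fset f z w) z' f' n -> term q z f z' f' n.+1.

End Termination.

(* [n] is only an upper bound on the number of steps, so that bounds can be weakened. *)
Definition ev (p : prog) (z : int) (f : ftape) (z' : int) (f' : ftape) (n : nat) :=
  exists2 m, m <= n & term (@pdelta p) (entry p) z f z' f' m.

Lemma ev_le p z f z' f' m n : m <= n -> ev p z f z' f' m -> ev p z f z' f' n.
Proof. by move=> mn [k km t]; exists k => //; apply: leq_trans mn. Qed.

Lemma ev_act g mv z f : ev (Act g mv) z f (z + dmv mv)%R (fset f z (g (f z))) 1.
Proof. by exists 1 => //; constructor. Qed.

Lemma term_seq1 a b q z f z1 f1 z2 f2 n1 n2 :
  term (@pdelta a) q z f z1 f1 n1 -> term (@pdelta (Seq a b)) (inr (entry b)) z1 f1 z2 f2 n2 ->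
  term (@pdelta (Seq a b)) (inl q) z f z2 f2 (n1 + n2).
Proof.
move=> t1 t2; elim: t1 t2 => {q z f z1 f1 n1} [q z f w mv E|q z f w mv q1 z' f' n E _ IH] t2.
  by rewrite add1n; apply: term_next t2; rewrite /= E.
by rewrite addSn; apply: term_next (IH t2); rewrite /= E.
Qed.

Lemma term_lift (p p' : prog) (h : pt p -> pt p') :
  (forall q s, pdelta (h q) s = mapq (omap h) (pdelta q s)) ->
  forall q z f z' f' n, term (@pdelta p) q z f z' f' n -> term (@pdelta p') (h q) z f z' f' n.
Proof.
move=> H q z f z' f' n; elim=> {q z f z' f' n} [q z f w mv E|q z f w mv q1 z' f' n E _ IH].
  by constructor; rewrite H E.
by apply: term_next IH; rewrite H E.
Qed.

Lemma ev_seq a b z f z1 f1 z2 f2 n1 n2 :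
  ev a z f z1 f1 n1 -> ev b z1 f1 z2 f2 n2 -> ev (Seq a b) z f z2 f2 (n1 + n2).
Proof.
move=> [m1 l1 t1] [m2 l2 t2]; exists (m1 + m2); first exact: leq_add.
exact: term_seq1 t1 (term_lift (h := inr) (p' := Seq a b) (fun _ _ => erefl) t2).
Qed.

Lemma ev_cond (t : option Sym -> bool) a b z f z' f' n :
  ev (if t (f z) then a else b) z f z' f' n -> ev (Cond t a b) z f z' f' n.+1.
Proof.
move=> [m l T]; exists m.+1 => //.
apply: (@term_next _ _ _ _ _ (f z) MStay
         (Some (if t (f z) then inl (entry a) else inr (entry b)))) => //.
rewrite fset_id GRing.addr0; case: (t (f z)) T => T.
  exact: (term_lift (h := fun q => Some (inl q)) (p' := Cond t a b) (fun _ _ => erefl) T).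
exact: (term_lift (h := fun q => Some (inr q)) (p' := Cond t a b) (fun _ _ => erefl) T).
Qed.

Lemma ev_while0 (t : option Sym -> bool) a z f : ~~ t (f z) -> ev (While t a) z f z f 1.
Proof.
move=> H; exists 1 => //.
have := @term_halt _ (@pdelta (While t a)) None z f (f z) MStay.
by rewrite fset_id GRing.addr0; apply; rewrite /= (negbTE H).
Qed.

Lemma ev_whileS (t : option Sym -> bool) a z f z1 f1 z2 f2 n1 n2 :
  t (f z) -> ev a z f z1 f1 n1 -> ev (While t a) z1 f1 z2 f2 n2 ->
  ev (While t a) z f z2 f2 (n1 + n2).+1.
Proof.
move=> H [m1 l1 t1] [m2 l2 t2]; exists (m1 + m2).+1; first by rewrite ltnS leq_add.
apply: (@term_next _ _ _ _ _ (f z) MStay (Some (entry a))); first by rewrite /= H.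
rewrite fset_id GRing.addr0.
elim: t1 t2 {H l1} => {z f z1 f1 m1} [q z f w mv E|q z f w mv q1 z' f' n E _ IH] t2.
  by rewrite add1n; apply: term_next t2; rewrite /= E.
by rewrite addSn; apply: term_next (IH t2); rewrite /= E.
Qed.

(** * From integer-indexed tapes to machine configurations *)

Definition tape_at (tp : tape) (z : int) (f : ftape) : Prop :=
  let: (l, h, r) := tp in
  [/\ f z = h, forall i : nat, f (z - 1 - i%:Z)%R = nth None l i
    & forall i : nat, f (z + 1 + i%:Z)%R = nth None r i].

Lemma tape_at_move l h r z f w mv :
  tape_at (l, h, r) z f -> tape_at (move_tape mv (l, w, r)) (z + dmv mv)%R (fset f z w).
Proof.
move=> [_ Hl Hr].
have El (i : nat) y : (y = z - 1 - i%:Z)%R -> fset f z w y = nth None l i.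
  by move=> ->; rewrite /fset ifN ?Hl //; lia.
have Er (i : nat) y : (y = z + 1 + i%:Z)%R -> fset f z w y = nth None r i.
  by move=> ->; rewrite /fset ifN ?Hr //; lia.
have E0 y : (y = z)%R -> fset f z w y = w by move=> ->; rewrite /fset eqxx.
case: mv => /=.
- case: l {Hl} El => [|a l] El; split.
  + by rewrite (El 0) //=; lia.
  + by move=> i; rewrite (El i.+1) //; [rewrite !nth_default | lia].
  + by case=> [|i]; [rewrite E0 //; lia | rewrite (Er i) //=; lia].
  + by rewrite (El 0) //=; lia.
  + by move=> i; rewrite (El i.+1) //; lia.
  + by case=> [|i]; [rewrite E0 //; lia | rewrite (Er i) //=; lia].
- case: r {Hr} Er => [|a r] Er; split.
  + by rewrite (Er 0) //=; lia.
  + by case=> [|i]; [rewrite E0 //; lia | rewrite (El i) //=; lia].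
  + by move=> i; rewrite (Er i.+1) //; [rewrite !nth_default | lia].
  + by rewrite (Er 0) //=; lia.
  + by case=> [|i]; [rewrite E0 //; lia | rewrite (El i) //=; lia].
  + by move=> i; rewrite (Er i.+1) //; lia.
- split; first by rewrite E0 //; lia.
  + by move=> i; apply: El; lia.
  + by move=> i; apply: Er; lia.
Qed.

Lemma term_iter p q z f z' f' n (tp : tape) :
  term (@pdelta p) q z f z' f' n -> tape_at tp z f ->
  exists2 tp', iter n (@step (mach p)) (Some q, tp) = (None, tp') & tape_at tp' z' f'.
Proof.
move=> T; elim: T tp => {q z f z' f' n} [q z f w mv E|q z f w mv q1 z' f' n E _ IH] [[l h] r] H.
  have Eh : f z = h by case: H.
  exists (move_tape mv (l, w, r)); last exact: tape_at_move H.
  by rewrite /= -Eh E.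
have Eh : f z = h by case: H.
have [tp' H1 H2] := IH _ (tape_at_move w mv H).
by exists tp' => //; rewrite iterSr /= -Eh E.
Qed.

Lemma read_outE (s : seq (option Sym)) (y : seq Sym) :
  (forall i, nth None s i = nth None (map Some y) i) -> read_out s = y.
Proof.
elim: s y => [|a s IH] [|b y] H //=; first by have := H 0.
  by have := H 0 => /= ->.
have := H 0 => /= ->; congr cons; apply: IH => i; exact: (H i.+1).
Qed.

Lemma ev_mach p x f z' f' n y :
  (forall i : nat, f (1 + i%:Z)%R = nth None (map Some x) i) ->
  (forall i : nat, f (- i%:Z)%R = None) ->
  ev p 1%R f z' f' n ->
  (forall i : nat, f' (z' + i%:Z)%R = nth None (map Some y) i) ->
  exists m, [/\ m <= n, halted (run (mach p) m x) & output (run (mach p) m x) = y].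
Proof.
move=> Hx H0 [m mn T] Hy; exists m.
have [|tp' E] := term_iter (tp := (init (mach p) x).2) T.
  case: x Hx => [|a x] Hx /=; split.
  - by have := Hx 0; rewrite GRing.addr0.
  - by move=> i; rewrite nth_nil -(H0 i); congr f; lia.
  - by move=> i; rewrite nth_nil -[RHS](Hx i.+1); congr f; lia.
  - by have := Hx 0; rewrite GRing.addr0.
  - by move=> i; rewrite nth_nil -(H0 i); congr f; lia.
  - by move=> i; rewrite -[RHS](Hx i.+1); congr f; lia.
have -> : run (mach p) m x = (None, tp') by rewrite -E; rewrite /run; case: (x).
case: tp' {E} => [[l h] r] [Eh El Er]; split=> //.
rewrite /output; apply: read_outE => -[|i] /=; first by rewrite -Eh -(Hy 0) GRing.addr0.
by rewrite -[LHS]Er -[RHS](Hy i.+1); congr f'; lia.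
Qed.

(** * Stacks on interleaved tracks *)

Inductive scmd :=
| Skip
| Push of nat & Sym
| SSeq of scmd & scmd
| Pop of nat & (Sym -> scmd) & scmd
| Drain of nat & (Sym -> scmd).

Definition store := nat -> seq Sym.

Definition sset (st : store) (j : nat) (s : seq Sym) : store :=
  fun i => if i == j then s else st i.

Inductive exec : scmd -> store -> store -> nat -> Prop :=
| exec_skip st : exec Skip st st 1
| exec_push j a st : exec (Push j a) st (sset st j (a :: st j)) 1
| exec_seq c1 c2 st st1 st2 n1 n2 :
    exec c1 st st1 n1 -> exec c2 st1 st2 n2 -> exec (SSeq c1 c2) st st2 (n1 + n2)
| exec_pop0 j g c st st' n :
    st j = [::] -> exec c st st' n -> exec (Pop j g c) st st' n.+1
| exec_popS j g c st a s st' n :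
    st j = a :: s -> exec (g a) (sset st j s) st' n -> exec (Pop j g c) st st' n.+1
| exec_drain0 j g st : st j = [::] -> exec (Drain j g) st st 1
| exec_drainS j g st a s st1 st2 n1 n2 :
    st j = a :: s -> exec (g a) (sset st j s) st1 n1 -> exec (Drain j g) st1 st2 n2 ->
    exec (Drain j g) st st2 (n1 + n2).+1.

Fixpoint tracks_le (k : nat) (c : scmd) : Prop :=
  match c with
  | Skip => True
  | Push j _ => j <= k
  | SSeq c1 c2 => tracks_le k c1 /\ tracks_le k c2
  | Pop j g c => [/\ j <= k, forall a, tracks_le k (g a) & tracks_le k c]
  | Drain j g => j <= k /\ forall a, tracks_le k (g a)
  end.

Lemma tracks_leW k k' c : k <= k' -> tracks_le k c -> tracks_le k' c.
Proof.
move=> kk; elim: c => //= [j a jk|c1 I1 c2 I2 [/I1 h1 /I2 h2]|j g Ig c Ic [h1 h2 /Ic h3]|j g Ig [h1 h2]].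
- exact: leq_trans kk.
- by split.
- by split=> // [|a]; [apply: leq_trans kk | apply: Ig].
- by split=> // [|a]; [apply: leq_trans kk | apply: Ig].
Qed.

Lemma tracks_le_ex c : exists k, tracks_le k c.
Proof.
have fam (g : Sym -> scmd) : (forall a, exists k, tracks_le k (g a)) ->
    exists k, forall a, tracks_le k (g a).
  move=> H; have [[k1 h1] [k2 h2] [k3 h3] [k4 h4]] := And4 (H Zs) (H Os) (H Ss) (H Ts).
  exists (maxn (maxn k1 k2) (maxn k3 k4)); case;
    [apply: tracks_leW h1 | apply: tracks_leW h2 | apply: tracks_leW h3 | apply: tracks_leW h4]; lia.
elim: c => [|j a|c1 [k1 h1] c2 [k2 h2]|j g /fam [k1 h1] c [k2 h2]|j g /fam [k1 h1]].
- by exists 0.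
- by exists j; apply: leqnn.
- by exists (maxn k1 k2); split; [apply: tracks_leW h1 | apply: tracks_leW h2]; lia.
- exists (maxn j (maxn k1 k2)); split; [lia | move=> a; apply: tracks_leW (h1 a) | apply: tracks_leW h2]; lia.
- by exists (maxn j k1); split; [lia | move=> a; apply: tracks_leW (h1 a); lia].
Qed.

Definition go mv n := iter n (Seq (Act id mv)) (Act id MStay).
Definition isS (s : option Sym) : bool := s.
Definition wr a := Act (fun _ => a) MStay.

Lemma ev_go mv n z f : ev (go mv n) z f (z + dmv mv * n%:Z)%R f n.+1.
Proof.
elim: n z => [|n IH] z.
  by have := ev_act id MStay z f; rewrite fset_id GRing.mulr0.
rewrite /go iterS -/(go mv n).
have E := ev_act id mv z f; rewrite fset_id in E.
have := ev_seq E (IH _); rewrite add1n.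
by congr (ev _ _ _ _ _ _); case: mv {E IH} => /=; lia.
Qed.

Lemma ev_to p z f z1 z' f' m n : ev p z f z1 f' m -> z1 = z' -> m <= n -> ev p z f z' f' n.
Proof. by move=> H <- mn; apply: ev_le H. Qed.

Lemma ev_wr a z f : ev (wr a) z f z (fset f z a) 1.
Proof. by have := ev_act (fun _ => a) MStay z f; rewrite GRing.addr0. Qed.

Definition is_sym (a : Sym) (s : option Sym) : bool :=
  match a, s with
  | Zs, Some Zs | Os, Some Os | Ss, Some Ss | Ts, Some Ts => true
  | _, _ => false
  end.

Definition by_sym (g : Sym -> prog) :=
  Cond (is_sym Zs) (g Zs) (Cond (is_sym Os) (g Os) (Cond (is_sym Ss) (g Ss) (g Ts))).

Lemma ev_by_sym g a z f z' f' n :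
  f z = Some a -> ev (g a) z f z' f' n -> ev (by_sym g) z f z' f' (n + 3).
Proof.
move=> E H.
case: a E H => E H; rewrite addn3.
- by apply: (@ev_le _ _ _ _ _ n.+1); [lia | apply: ev_cond; rewrite E].
- by apply: (@ev_le _ _ _ _ _ n.+2); [lia | do 2 (apply: ev_cond; rewrite E)].
- by do 3 (apply: ev_cond; rewrite E).
- by do 3 (apply: ev_cond; rewrite E).
Qed.

Section Simulation.
Variable k : nat.

(* Track 0 is the half-line of cells 1, 2, ...; the tracks 1 .. k are interleaved on the negative
   half-line in blocks of width [k.+1], whose first cell is a header marking the blocks in use.
   Cell 0 stays blank.  Stacks grow away from cell 0. *)
Notation w := k.+1.
Definition addr (j b : nat) : int :=
  if j is 0 then b.+1%:Z else (- (b * w + (w - j))%N%:Z)%R.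
Definition hdr (b : nat) : int := (- (b.+1 * w)%N%:Z)%R.

Definition enter j := if j is 0 then go MRight 1 else go MLeft (w - j).
Definition leave j := if j is 0 then go MLeft 1 else go MRight (w - j).
Definition adv j := if j is 0 then go MRight 1 else go MLeft w.
Definition back j := if j is 0 then go MLeft 1 else go MRight w.
Definition seek j := While isS (adv j).
(** Headers lie at multiples of [w], in the residue class of cell 0, so jumps of [w] over marked
    headers stop exactly at cell 0; jumps along the track itself would miss it. On track 0 the first
    move is unconditional because the current cell may just have been erased. *)
Definition home j :=
  if j is 0 then Seq (go MLeft 1) (While isS (go MLeft 1))
  else Seq (go MLeft j) (Seq (wr (Some Os)) (While isS (go MRight w))).

Definition mark j b f := if j is 0 then f else fset f (hdr b) (Some Os).

(** The head of the list is the top of the stack, farthest from cell 0, hence [rev]. The number [H]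
    of marked headers is only an upper bound for the heights: pops leave the marks in place. *)
Definition rep (st : store) (f : ftape) : Prop :=
  [/\ f 0%R = None,
      forall j b, j <= k -> f (addr j b) = nth None (map Some (rev (st j))) b
    & exists2 H, forall j, 0 < j <= k -> size (st j) <= H &
        forall b, f (hdr b) = if b < H then Some Os else None].

Notation u := (k.+3).

Lemma addr_inj j b j' b' : j <= k -> j' <= k -> addr j b = addr j' b' -> j = j' /\ b = b'.
Proof.
case: j j' => [|j] [|j'] /= hj hj' E; try by [lia | split; lia].
have /= E' : b * w + (w - j.+1) = b' * w + (w - j'.+1) by lia.
have Eb : b = b'.
  by have := congr1 (divn^~ w) E'; rewrite !divnMDl // !divn_small ?addn0 //; lia.
by move: E'; rewrite Eb => /eqP; rewrite eqn_add2l => /eqP; split => //; lia.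
Qed.

Lemma addr_hdr j b b' : j <= k -> addr j b <> hdr b'.
Proof.
case: j => [|j] hj; rewrite /addr /hdr; first lia.
move=> E; have /(congr1 (modn^~ w)) : b * w + (w - j.+1) = b'.+1 * w by lia.
by rewrite modnMDl modnMl modn_small; lia.
Qed.

Lemma addr0 j b : j <= k -> addr j b <> 0%R.
Proof. by case: j => [|j] hj /=; lia. Qed.

Lemma hdr0 b : hdr b <> 0%R.
Proof. by rewrite /hdr; lia. Qed.

Lemma hdr_inj : injective hdr.
Proof. by move=> b b'; rewrite /hdr => E; have /eqP : b.+1 * w = b'.+1 * w by [lia]; rewrite eqn_pmul2r //; lia. Qed.

Lemma fset_ne f z a y : y <> z -> fset f z a y = f y.
Proof. by rewrite /fset; case: eqP. Qed.

Lemma fset_eq f z a : fset f z a z = a.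
Proof. by rewrite /fset eqxx. Qed.

Lemma mark_addr j b f j' b' : j' <= k -> mark j b f (addr j' b') = f (addr j' b').
Proof. by move=> h; case: j => //= j; rewrite fset_ne //; apply: addr_hdr. Qed.

(** Covers push and pop at once: [b] is the first free cell of the track in the former case and its
    top cell in the latter. *)
Lemma rep_write st f j b a s :
  rep st f -> j <= k -> b <= size (st j) ->
  (forall i, nth None (map Some (rev s)) i =
             if i == b then a else nth None (map Some (rev (st j))) i) ->
  size s <= b.+1 ->
  rep (sset st j s) (mark j b (fset f (addr j b) a)).
Proof.
move=> [f0 ft [H HH fh]] hj hb Hs ss; split.
- have E : fset f (addr j b) a 0%R = None.
    by rewrite fset_ne //; apply/nesym/addr0.
  by case: (j) E => //= j' <-; rewrite fset_ne //; apply/nesym/hdr0.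
- move=> j' b' hj'; rewrite mark_addr // /sset; have [->|jj] := eqVneq j' j.
    rewrite Hs; have [->|bb] := eqVneq b' b; first by rewrite fset_eq.
    by rewrite fset_ne ?ft // => /(addr_inj hj hj) [_ e]; rewrite e eqxx in bb.
  by rewrite fset_ne ?ft // => /(addr_inj hj' hj) [e]; rewrite e eqxx in jj.
- exists (if j is 0 then H else maxn H b.+1).
    move=> i hi; rewrite /sset; case: eqP => [e|_].
      by case: (j) e => [|j'] e; lia.
    by have := HH _ hi; case: (j) => *; lia.
  move=> b'; case: j hj hb {Hs} => [|j] hj hb; rewrite /mark.
    by rewrite fset_ne //; apply/nesym/addr_hdr.
  have [->|bb] := eqVneq b' b; first by rewrite fset_eq ifT //; lia.
  rewrite fset_ne; last by move/hdr_inj => e; rewrite e eqxx in bb.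
  rewrite fset_ne; last by apply/nesym/addr_hdr.
  have hH := HH j.+1 hj; rewrite fh; case: ltnP => h1; case: ltnP => h2 //; lia.
Qed.

Lemma rep_some st f j b : rep st f -> j <= k -> isS (f (addr j b)) = (b < size (st j)).
Proof.
move=> [_ ft _] hj; rewrite ft // -(size_rev (st j)); elim: (rev _) b => [|a s IH] [|b] //=.
Qed.

Lemma ev_adv j b f : ev (adv j) (addr j b) f (addr j b.+1) f u.
Proof.
case: j => [|j] /=.
  by apply: ev_to (ev_go MRight 1 _ f) _ _ => //=; lia.
by apply: ev_to (ev_go MLeft w _ f) _ _ => //=; lia.
Qed.

Lemma ev_back j b f : ev (back j) (addr j b.+1) f (addr j b) f u.
Proof.
case: j => [|j] /=.
  by apply: ev_to (ev_go MLeft 1 _ f) _ _ => //=; lia.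
by apply: ev_to (ev_go MRight w _ f) _ _ => //=; lia.
Qed.

Lemma ev_enter j f : ev (enter j) 0%R f (addr j 0) f u.
Proof.
case: j => [|j] /=.
  by apply: ev_to (ev_go MRight 1 _ f) _ _ => //=; lia.
by apply: ev_to (ev_go MLeft (w - j.+1) _ f) _ _ => //=; lia.
Qed.

Lemma ev_leave j f : ev (leave j) (addr j 0) f 0%R f u.
Proof.
case: j => [|j] /=.
  by apply: ev_to (ev_go MLeft 1 _ f) _ _ => //=; lia.
by apply: ev_to (ev_go MRight (w - j.+1) _ f) _ _ => //=; lia.
Qed.

Lemma ev_seek j st f : rep st f -> j <= k ->
  ev (seek j) (addr j 0) f (addr j (size (st j))) f ((size (st j)) * u.+1).+1.
Proof.
move=> R hj; suff H n b : n + b = size (st j) ->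
    ev (seek j) (addr j b) f (addr j (size (st j))) f (n * u.+1).+1.
  by apply: H; rewrite addn0.
elim: n b => [|n IH] b Hn.
  by rewrite -Hn; apply: ev_while0; rewrite (rep_some _ R hj) -Hn ltnn.
apply: (@ev_le _ _ _ _ _ (u + (n * u.+1).+1).+1); first by lia.
apply: ev_whileS (ev_adv j b f) (IH b.+1 _); last by lia.
by rewrite (rep_some _ R hj) -Hn; lia.
Qed.

Lemma ev_home j b st f a : rep st f -> j <= k -> b <= size (st j) ->
  ev (home j) (addr j b) (fset f (addr j b) a) 0%R (mark j b (fset f (addr j b) a))
     (b.+2 * u.+1).+2.
Proof.
move=> R hj hb; have [f0 ft [H HH fh]] := R.
case: j hj hb => [|j] hj hb.
  set g := fset _ _ _; rewrite -[mark _ _ _]/g.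
  have g0 : g 0%R = None by rewrite /g fset_ne //; apply/nesym/addr0.
  have L n : n <= b -> ev (While isS (go MLeft 1)) n%:Z g 0%R g (n * u.+1).+1.
    elim: n => [|n IH] nb; first by apply: ev_while0; rewrite g0.
    apply: (@ev_le _ _ _ _ _ (2 + (n * u.+1).+1).+1); first by lia.
    apply: ev_whileS (IH _); last by lia.
      rewrite /g fset_ne; last by move/(@addr_inj 0 n 0 b hj hj) => [_]; lia.
      by rewrite (@rep_some _ _ 0 n R hj); lia.
    by apply: ev_to (ev_go MLeft 1 _ g) _ _ => //=; lia.
  apply: (@ev_le _ _ _ _ _ (2 + (b * u.+1).+1)); first by lia.
  by apply: ev_seq (L _ (leqnn b)); apply: ev_to (ev_go MLeft 1 _ g) _ _ => //=; lia.
set g := mark _ _ _.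
have g0 : g 0%R = None.
  rewrite /g /mark fset_ne; last exact/nesym/hdr0.
  by rewrite fset_ne //; apply/nesym/addr0.
have L n : n <= b -> ev (While isS (go MRight w)) (hdr n) g 0%R g (n.+1 * u.+1).+1.
  have gS m : m <= b -> isS (g (hdr m)).
    move=> mb; rewrite /g /mark /fset; case: eqP => // ne; case: eqP => [/esym/(addr_hdr hj)[]|_].
    rewrite fh ifT //; have := HH j.+1 hj; case: (ltngtP m b) mb ne => // [*|->] //; lia.
  elim: n => [|n IH] nb.
    apply: (@ev_le _ _ _ _ _ (u + 1).+1); first by lia.
    apply: ev_whileS (gS 0 nb) _ (ev_while0 _ _); last by rewrite g0.
    by apply: ev_to (ev_go MRight w _ g) _ _; rewrite /hdr //=; lia.
  apply: (@ev_le _ _ _ _ _ (u + (n.+1 * u.+1).+1).+1); first by lia.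
  apply: ev_whileS (gS n.+1 nb) _ (IH _); last by lia.
  by apply: ev_to (ev_go MRight w _ g) _ _; rewrite /hdr //=; lia.
apply: (@ev_le _ _ _ _ _ (j.+2 + (1 + (b.+1 * u.+1).+1))); first by lia.
apply: ev_seq (ev_seq (ev_wr (Some Os) _ _) (L b _)) => //.
by apply: ev_to (ev_go MLeft j.+1 _ _) _ _ => //; rewrite /hdr /=; lia.
Qed.

(** The popped symbol survives in the control only: the erasure, the way home and the continuation
    are instantiated once for each symbol. *)
Definition popb j (g : Sym -> prog) :=
  Seq (seek j) (Seq (back j) (by_sym (fun a => Seq (wr None) (Seq (home j) (g a))))).

Fixpoint sim (c : scmd) : prog :=
  match c with
  | Skip => Act id MStay
  | Push j a => Seq (enter j) (Seq (seek j) (Seq (wr (Some a)) (home j)))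
  | SSeq c1 c2 => Seq (sim c1) (sim c2)
  | Pop j g c => Seq (enter j) (Cond isS (popb j (fun a => sim (g a))) (Seq (leave j) (sim c)))
  | Drain j g => Seq (enter j)
      (Seq (While isS (popb j (fun a => Seq (sim (g a)) (enter j)))) (leave j))
  end.

Lemma ev_push j a st f : rep st f -> j <= k ->
  exists2 f', rep (sset st j (a :: st j)) f'
            & ev (sim (Push j a)) 0%R f 0%R f' (u.+1 * (2 * size (st j) + 10)).
Proof.
move=> R hj; exists (mark j (size (st j)) (fset f (addr j (size (st j))) (Some a))).
  apply: rep_write => // i; rewrite rev_cons map_rcons nth_rcons size_map size_rev.
  by case: ltngtP => // h; rewrite nth_default ?size_map ?size_rev // ltnW.
apply: (ev_le _ (ev_seq (ev_enter j f) (ev_seq (ev_seek R hj) (ev_seq (ev_wr _ _ _) (ev_home _ R hj _))))) => //.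
lia.
Qed.

Lemma ev_popb j a s st f : rep st f -> j <= k -> st j = a :: s ->
  exists2 f', rep (sset st j s) f'
    & forall g z' f'' n, ev (g a) 0%R f' z' f'' n ->
        ev (popb j g) (addr j 0) f z' f'' (u.+1 * (2 * size (st j) + 10) + n).
Proof.
move=> R hj E; exists (mark j (size s) (fset f (addr j (size s)) None)).
  apply: rep_write => //; rewrite E //= => i; rewrite rev_cons map_rcons nth_rcons size_map size_rev.
  by case: ltngtP => // h; rewrite nth_default // size_map size_rev; lia.
move=> g z' f'' n Hg.
have fa : f (addr j (size s)) = Some a.
  by case: R => _ -> // _; rewrite E rev_cons map_rcons nth_rcons size_map size_rev ltnn eqxx.
have hs : size s <= size (st j) by rewrite E.
have Hs := ev_seek R hj; rewrite E /= in Hs.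
apply: (ev_le _ (ev_seq Hs (ev_seq (ev_back j _ f) (ev_by_sym fa
  (ev_seq (ev_wr _ _ _) (ev_seq (ev_home _ R hj hs) Hg)))))).
rewrite E /=; lia.
Qed.

(** Cost of one stack step at heights up to [x]: the walk out and back gives [2 * x], and 20 leaves
    room for entering, leaving and testing. *)
Definition unit_cost x := u.+1 * (2 * x + 20).

Lemma unit_cost_le n x y : x <= y -> n * unit_cost x <= n * unit_cost y.
Proof. by move=> xy; rewrite !leq_mul // leq_add2r leq_mul2l xy orbT. Qed.

Lemma unit_cost_ge x y : x <= y -> u.+1 * (2 * x + 10) + 10 * u.+1 <= unit_cost y.
Proof.
move=> xy; rewrite [10 * _]mulnC /unit_cost -mulnDr leq_mul2l; lia.
Qed.

(** Each step pushes at most one symbol. This bounds the length of the walks in the simulation by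
    the running time. *)
Lemma exec_size c st st' n m : exec c st st' n ->
  (forall j, size (st j) <= m) -> forall j, size (st' j) <= m + n.
Proof.
move=> X; elim: X m => {c st st' n}.
- by move=> st m H j; apply: leq_trans (H j) _; lia.
- by move=> j a st m H i; rewrite /sset; case: eqP => _ /=; have := H i; have := H j; lia.
- by move=> c1 c2 st st1 st2 n1 n2 _ I1 _ I2 m /I1/I2 H j; rewrite addnA.
- by move=> j g c st st' n _ _ I m /I H i; rewrite addnS ltnW // ltnS.
- move=> j g c st a s st' n E _ I m H i.
  have /I/(_ i) : forall i, size (sset st j s i) <= m.
    by move=> i'; rewrite /sset; case: eqP => // _; have := H j; rewrite E /=; lia.
  by lia.
- by move=> j g st _ m H i; apply: leq_trans (H i) _; lia.
- move=> j g st a s st1 st2 n1 n2 E _ I1 _ I2 m H i.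
  have /I1/I2/(_ i) : forall i, size (sset st j s i) <= m.
    by move=> i'; rewrite /sset; case: eqP => // _; have := H j; rewrite E /=; lia.
  by lia.
Qed.

Lemma exec_sim c st st' n m f : exec c st st' n -> tracks_le k c ->
  (forall j, size (st j) <= m) -> rep st f ->
  exists2 f', rep st' f' & ev (sim c) 0%R f 0%R f' (n * unit_cost (m + n)).
Proof.
(* The tail of a [Drain] run is again a [Drain] run, whereas its simulation enters and leaves the
   track only once. The induction therefore speaks of the bare loop, with a reserve of [2 * u] for
   entering and leaving. *)
move=> X; pose goal c f f' n m :=
  if c is Drain j g then
    exists2 b, 2 * u + b <= n * unit_cost (m + n) &
     ev (While isS (popb j (fun a => Seq (sim (g a)) (enter j)))) (addr j 0) f (addr j 0) f' b
  else ev (sim c) 0%R f 0%R f' (n * unit_cost (m + n)).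
have goalE c0 f0 f1 n0 m0 : goal c0 f0 f1 n0 m0 -> ev (sim c0) 0%R f0 0%R f1 (n0 * unit_cost (m0 + n0)).
  case: c0 => // j g [b hb He].
  by apply: ev_le (ev_seq (ev_enter _ _) (ev_seq He (ev_leave _ _))); lia.
move=> tc hm R; suff [f' R' G] : exists2 f', rep st' f' & goal c f f' n m by exists f' => //; apply: goalE.
elim: X m f tc hm R => {c st st' n}.
- move=> st m f _ _ R; exists f => //=.
  apply: ev_to (ev_go MRight 0 0%R f) _ _ => //; rewrite /unit_cost; lia.
- move=> j a st m f hj hm R; have [f' R' E] := ev_push a R hj; exists f' => //.
  apply: ev_le E; rewrite mul1n leq_mul2l /=; have := hm j; lia.
- move=> c1 c2 st st1 st2 n1 n2 X1 I1 X2 I2 m f [t1 t2] hm R.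
  have [f1 R1 /goalE G1] := I1 m f t1 hm R.
  have [f2 R2 /goalE G2] := I2 (m + n1) f1 t2 (exec_size X1 hm) R1.
  exists f2 => //; apply: ev_le (ev_seq G1 G2); rewrite mulnDl addnA leq_add2r.
  by apply: unit_cost_le; lia.
- move=> j g c st st' n E X I m f [hj _ tc] hm R.
  have [f' R' /goalE G] := I m f tc hm R; exists f' => //.
  have Hc : ~~ isS (f (addr j 0)) by rewrite (rep_some _ R hj) E.
  apply: ev_le (ev_seq (ev_enter _ _) (ev_cond (n := u + n * unit_cost (m + n)) _)).
    have := @unit_cost_le n (m + n) (m + n.+1); have := @unit_cost_ge 0 (m + n.+1); lia.
  by rewrite (negbTE Hc); apply: ev_seq (ev_leave _ _) G.
- move=> j g c st a s st' n E X I m f [hj tg _] hm R.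
  have [f1 R1 P] := ev_popb R hj E.
  have hm1 i : size (sset st j s i) <= m.
    by rewrite /sset; case: eqP => // _; have := hm j; rewrite E /=; lia.
  have [f' R' /goalE G] := I m f1 (tg a) hm1 R1; exists f' => //.
  have Hc : isS (f (addr j 0)) by rewrite (rep_some _ R hj) E.
  apply: ev_le (ev_seq (ev_enter _ _) (ev_cond _)); last first.
    by rewrite Hc; apply: P G.
  have := @unit_cost_le n (m + n) (m + n.+1).
  have := @unit_cost_ge (size (st j)) (m + n.+1); have := hm j; lia.
- move=> j g st E m f [hj _] hm R; exists f => //=; exists 1; first by rewrite /unit_cost; lia.
  by apply: ev_while0; rewrite (rep_some _ R hj) E.
- move=> j g st a s st1 st2 n1 n2 E X1 I1 X2 I2 m f [hj tg] hm R.
  have [f1 R1 P] := ev_popb R hj E.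
  have hm1 i : size (sset st j s i) <= m.
    by rewrite /sset; case: eqP => // _; have := hm j; rewrite E /=; lia.
  have [f2 R2 /goalE G2] := I1 m f1 (tg a) hm1 R1.
  have [f3 R3 [b hb G3]] := I2 (m + n1) f2 (conj hj tg) (exec_size X1 hm1) R2.
  exists f3 => //=; have Hc : isS (f (addr j 0)) by rewrite (rep_some _ R hj) E.
  have B := P (fun a => Seq (sim (g a)) (enter j)) _ _ _ (ev_seq G2 (ev_enter _ _)).
  eexists; last exact: ev_whileS Hc B G3.
  have := @unit_cost_le n1 (m + n1) (m + (n1 + n2).+1).
  have := @unit_cost_le n2 (m + n1 + n2) (m + (n1 + n2).+1).
  have := @unit_cost_ge (size (st j)) (m + (n1 + n2).+1); have := hm j; lia.
Qed.

End Simulation.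

(** * String generators run in polynomial time *)

Lemma leq_expl m n e : m <= n -> m ^ e <= n ^ e.
Proof. by move=> mn; elim: e => // e IH; rewrite !expnS leq_mul. Qed.

Definition polyb (F : nat -> nat) := exists c e, forall n, F n <= poly c e n.

Lemma polyb_poly c e : polyb (poly c e).
Proof. by exists c, e. Qed.

Lemma polyb_const a : polyb (fun _ => a).
Proof. by exists a, 0 => n; rewrite /poly expn0 muln1. Qed.

Lemma polyb_id : polyb id.
Proof. by exists 1, 1 => n; rewrite /poly expn1 mul1n. Qed.

Lemma polyb_add F G : polyb F -> polyb G -> polyb (fun n => F n + G n).
Proof.
move=> [c1 [e1 h1]] [c2 [e2 h2]]; exists (c1 + c2), (e1 + e2) => n.
rewrite /poly mulnDl; apply: leq_add; [apply: leq_trans (h1 n) _ | apply: leq_trans (h2 n) _];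
  by rewrite /poly leq_mul2l leq_pexp2l ?orbT // ?leq_addr ?leq_addl.
Qed.

Lemma polyb_mul F G : polyb F -> polyb G -> polyb (fun n => F n * G n).
Proof.
move=> [c1 [e1 h1]] [c2 [e2 h2]]; exists (c1 * c2), (e1 + e2) => n.
by apply: leq_trans (leq_mul (h1 n) (h2 n)) _; rewrite /poly expnD mulnACA.
Qed.

Lemma polyb_comp c e G : polyb G -> polyb (fun n => poly c e (G n)).
Proof.
move=> [c2 [e2 h2]]; exists (c * (c2.+1) ^ e), (e2 * e) => n.
rewrite /poly -mulnA leq_mul // expnM -expnMn leq_expl //.
apply: leq_ltn_trans (h2 n) _; rewrite /poly mulSn -[X in X < _]add0n ltn_add2r expn_gt0 //.
Qed.

(** * Expressions, generators and their stack programs *)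

Definition env := nat -> nat.
Definition upd (E : env) (d v : nat) : env := fun i => if i == d then v else E i.

Inductive expr :=
| EVar of nat
| EConst of nat
| ELen
| EAdd of expr & expr
| ESub of expr & expr
| EMul of expr & expr
| EDiv of expr & expr
| EInp of Sym & expr.

Fixpoint eval (x : seq Sym) (E : env) (e : expr) : nat :=
  match e with
  | EVar k => E k
  | EConst c => c
  | ELen => size x
  | EAdd a b => eval x E a + eval x E b
  | ESub a b => eval x E a - eval x E b
  | EMul a b => eval x E a * eval x E b
  | EDiv a b => eval x E a %/ eval x E b
  | EInp a e => is_sym a (nth None (map Some x) (eval x E e))
  end.

Inductive gen :=
| GEmit of Sym
| GSeq of gen & gen
| GIf of expr & gen & gen
| GFor of expr & gen.

(* A loop uses two variables: [d] counts the remaining iterations, [d.+1] is the index. *)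
Fixpoint gout (x : seq Sym) (d : nat) (E : env) (g : gen) : seq Sym :=
  match g with
  | GEmit a => [:: a]
  | GSeq g1 g2 => gout x d E g1 ++ gout x d E g2
  | GIf e g1 g2 => if eval x E e is 0 then gout x d E g2 else gout x d E g1
  | GFor e g =>
      flatten [seq gout x d.+2 (upd (upd E d (eval x E e - i.+1)) d.+1 i) g | i <- iota 0 (eval x E e)]
  end.

Definition exb c st st' n := exists2 m, m <= n & exec c st st' m.

Lemma exb_to c st st1 st' m n : exb c st st1 m -> st1 = st' -> m <= n -> exb c st st' n.
Proof. by move=> [p pm X] <- mn; exists p => //; apply: leq_trans mn. Qed.

Lemma exb_conv c s1 s1' s s' m n :
  exb c s1 s1' m -> s1 = s -> s1' = s' -> m <= n -> exb c s s' n.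
Proof. by move=> H <-; apply: exb_to H. Qed.

Lemma exb_seq c1 c2 st st1 st2 n1 n2 :
  exb c1 st st1 n1 -> exb c2 st1 st2 n2 -> exb (SSeq c1 c2) st st2 (n1 + n2).
Proof. by move=> [m1 l1 X1] [m2 l2 X2]; exists (m1 + m2); [apply: leq_add | apply: exec_seq X1 X2]. Qed.

Lemma exb_skip st : exb Skip st st 1.
Proof. by exists 1 => //; constructor. Qed.

Lemma exb_push j a st : exb (Push j a) st (sset st j (a :: st j)) 1.
Proof. by exists 1 => //; constructor. Qed.

Lemma exb_pop j g c st st' n :
  (if st j is a :: s then exb (g a) (sset st j s) st' n else exb c st st' n) ->
  exb (Pop j g c) st st' n.+1.
Proof.
case E: (st j) => [|a s] [m mn X]; exists m.+1 => //; first exact: exec_pop0 X.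
exact: exec_popS X.
Qed.

Lemma exb_drain j g (S : nat -> store) s n :
  (forall i, i <= size s -> S i j = drop i s) ->
  (forall i, i < size s -> exb (g (nth Zs s i)) (sset (S i) j (drop i.+1 s)) (S i.+1) n) ->
  exb (Drain j g) (S 0) (S (size s)) (size s * n.+1 + 1).
Proof.
move=> HS HB; suff H p i : p + i = size s ->
    exb (Drain j g) (S i) (S (size s)) (p * n.+1 + 1) by apply: H; rewrite addn0.
elim: p i => [|p IH] i hi.
  move: hi; rewrite add0n => ->; exists 1 => //.
  by apply: exec_drain0; rewrite HS // drop_size.
have hi' : i < size s by rewrite -hi; lia.
have [m2 l2 X2] := IH i.+1 ltac:(lia); have [m1 l1 X1] := HB i hi'.
exists (m1 + m2).+1; first by rewrite mulSn addSn; lia.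
apply: exec_drainS X1 X2.
by rewrite (HS _ (ltnW hi')) (drop_nth Zs hi').
Qed.

(* Track 0 holds the output, track 1 the input, track 2 is scratch space for it, and the
   variable [i] is kept in unary on track [i.+3]. *)
Definition mk (o x y : seq Sym) (E : env) : store :=
  fun j => match j with 0 => o | 1 => x | 2 => y | i.+3 => nseq (E i) Os end.
Notation mkst o x E := (mk o x [::] E).

Lemma mkst_set o x y E d v : sset (mk o x y E) d.+3 (nseq v Os) = mk o x y (upd E d v).
Proof.
apply: functional_extensionality => -[|[|[|j]]] //=.
by rewrite /sset /upd /= !eqSS; case: eqP.
Qed.

Lemma mk_set0 o x y E s : sset (mk o x y E) 0 s = mk s x y E.
Proof. by apply: functional_extensionality => -[|[|[|j]]]. Qed.

Lemma mk_set1 o x y E s : sset (mk o x y E) 1 s = mk o s y E.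
Proof. by apply: functional_extensionality => -[|[|[|j]]]. Qed.

Lemma mk_set2 o x y E s : sset (mk o x y E) 2 s = mk o x s E.
Proof. by apply: functional_extensionality => -[|[|[|j]]]. Qed.

Definition incr d := Push d.+3 Os.
Definition loop d c := Drain d.+3 (fun _ => c).

Lemma exb_incr o x y E d : exb (incr d) (mk o x y E) (mk o x y (upd E d (E d).+1)) 1.
Proof. by apply: exb_to (exb_push _ _ _) _ _ => //; rewrite -mkst_set. Qed.

Lemma exb_loop_mk d c v (O X Y : nat -> seq Sym) (E : nat -> env) n :
  (forall i, i <= v -> E i d = v - i) ->
  (forall i, i < v ->
     exb c (mk (O i) (X i) (Y i) (upd (E i) d (v - i.+1)))
           (mk (O i.+1) (X i.+1) (Y i.+1) (E i.+1)) n) ->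
  exb (loop d c) (mk (O 0) (X 0) (Y 0) (E 0)) (mk (O v) (X v) (Y v) (E v)) (v * n.+1 + 1).
Proof.
move=> HE HB.
have := @exb_drain d.+3 (fun _ => c) (fun i => mk (O i) (X i) (Y i) (E i)) (nseq v Os) n.
rewrite size_nseq => H; apply: H => i hi; first by rewrite drop_nseq /= HE.
by rewrite drop_nseq mkst_set; apply: HB.
Qed.

Lemma exb_loop d c v (O : nat -> seq Sym) x (E : nat -> env) n :
  (forall i, i <= v -> E i d = v - i) ->
  (forall i, i < v ->
     exb c (mkst (O i) x (upd (E i) d (v - i.+1))) (mkst (O i.+1) x (E i.+1)) n) ->
  exb (loop d c) (mkst (O 0) x (E 0)) (mkst (O v) x (E v)) (v * n.+1 + 1).
Proof. exact: (@exb_loop_mk d c v O (fun _ => x) (fun _ => [::])). Qed.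

Lemma upd_upd E d v v' : upd (upd E d v) d v' = upd E d v'.
Proof. by apply: functional_extensionality => i; rewrite /upd; case: eqP. Qed.

Lemma upd_id E d : upd E d (E d) = E.
Proof. by apply: functional_extensionality => i; rewrite /upd; case: eqP => [->|]. Qed.

Lemma upd_eq E d v : upd E d v d = v.
Proof. by rewrite /upd eqxx. Qed.

Lemma upd_ne E d v i : i <> d -> upd E d v i = E i.
Proof. by rewrite /upd; case: eqP. Qed.

Ltac upds := rewrite /upd; repeat (case: eqP => ?); subst; try lia.
Ltac env_ext := apply: functional_extensionality => ?; upds.

Definition clear d := loop d Skip.

Lemma exb_clear o x E d : exb (clear d) (mkst o x E) (mkst o x (upd E d 0)) (2 * E d + 1).
Proof.
have H := @exb_loop d Skip (E d) (fun _ => o) x (fun i => upd E d (E d - i)) 1.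
apply: exb_conv (H _ _) _ _ _.
- by move=> i _; rewrite upd_eq.
- by move=> i hi; rewrite upd_upd; apply: exb_skip.
- by rewrite subn0 upd_id.
- by rewrite subnn.
- by rewrite mulnC.
Qed.

Definition shift k d := loop k (incr d).

Lemma exb_shift o x E k d : k <> d ->
  exb (shift k d) (mkst o x E) (mkst o x (upd (upd E k 0) d (E d + E k))) (2 * E k + 1).
Proof.
move=> kd.
have H := @exb_loop k (incr d) (E k) (fun _ => o) x
  (fun i => upd (upd E k (E k - i)) d (E d + i)) 1.
apply: exb_conv (H _ _) _ _ _.
- by move=> i _; rewrite upd_ne // upd_eq.
- move=> i hi; apply: exb_to (exb_incr _ _ _ _ _) _ _ => //; congr mk.
  by env_ext.
- by rewrite subn0 addn0 upd_id upd_id.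
- by rewrite subnn.
- by rewrite mulnC.
Qed.

(** Reading a unary stack destroys it, so its content is doubled into [d] and [t] and then moved
    back from [t]. *)
Definition copy k d t := SSeq (loop k (SSeq (incr d) (incr t))) (shift t k).

Lemma exb_copy o x E k d t : k <> d -> k <> t -> d <> t -> E t = 0 ->
  exb (copy k d t) (mkst o x E) (mkst o x (upd E d (E d + E k))) (5 * E k + 2).
Proof.
move=> kd kt dt t0.
have H := @exb_loop k (SSeq (incr d) (incr t)) (E k) (fun _ => o) x
  (fun i => upd (upd (upd E k (E k - i)) d (E d + i)) t i) 2.
have H1 := exb_seq (H _ _) (@exb_shift o x _ t k (nesym kt)).
apply: exb_conv (H1 _ _) _ _ _.
- by move=> i _; upds.
- move=> i hi /=; apply: exb_to (exb_seq (exb_incr _ _ _ _ _) (exb_incr _ _ _ _ _)) _ _ => //; congr mk.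
  by env_ext.
- by congr mk; env_ext.
- by congr mk; env_ext.
- by rewrite upd_eq; lia.
Qed.

Definition emul d :=
  SSeq (loop d (copy d.+1 d.+2 d.+3)) (SSeq (clear d.+1) (shift d.+2 d)).

Lemma exb_emul o x E d a b M : (forall i, d <= i -> E i = 0) -> a <= M -> b <= M ->
  exb (emul d) (mkst o x (upd (upd E d a) d.+1 b)) (mkst o x (upd E d (a * b)))
     (20 * M.+1 * M.+1).
Proof.
move=> E0 aM bM; set E1 := upd _ _ _.
have H := @exb_loop d (copy d.+1 d.+2 d.+3) a (fun _ => o) x
  (fun i => upd (upd E1 d (a - i)) d.+2 (i * b)) (5 * b + 2).
have H1 := exb_seq (H _ _) (exb_seq (exb_clear _ _ _ d.+1) (@exb_shift o x _ d.+2 d _)).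
apply: exb_conv (H1 _ _ _) _ _ _.
- by move=> i _; upds.
- move=> i hi; apply: exb_to (exb_copy _ _ _ _ _ _) _ _; try lia.
  + by rewrite /E1; upds; rewrite E0; lia.
  + by congr mk; rewrite /E1; env_ext; nia.
  + by rewrite /E1; upds.
- lia.
- by congr mk; rewrite /E1; env_ext; rewrite E0 //; lia.
- by congr mk; rewrite /E1; env_ext; rewrite ?E0 //; lia.
- have h : a * b <= M * M by apply: leq_mul.
  by rewrite /E1 /upd !eqxx !ifN; nia.
Qed.

(** Variable [d.+2] counts down from the divisor to the next increment of the quotient [d.+3], and
    is then reloaded from [d.+1]. The inner [Pop] tests whether it has reached 0 and otherwise
    restores the symbol taken. For divisor 0 it is empty throughout, which gives quotient 0 as [%/]
    does. *)
Definition edivn d :=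
  SSeq (copy d.+1 d.+2 d.+3)
   (SSeq (loop d (Pop d.+2.+3 (fun _ => Pop d.+2.+3 (fun a => Push d.+2.+3 a)
                                   (SSeq (incr d.+3) (copy d.+1 d.+2 d.+4))) Skip))
   (SSeq (clear d.+1) (SSeq (clear d.+2) (shift d.+3 d)))).

Lemma exb_popr d g c o x E st' n :
  (if E d is v.+1 then exb (g Os) (mkst o x (upd E d v)) st' n else exb c (mkst o x E) st' n) ->
  exb (Pop d.+3 g c) (mkst o x E) st' n.+1.
Proof.
move=> H; apply: exb_pop => /=; case: (E d) H => [|v] //=.
by rewrite mkst_set.
Qed.

Lemma exb_edivn o x E d a b M : (forall i, d <= i -> E i = 0) -> a <= M -> b <= M ->
  exb (edivn d) (mkst o x (upd (upd E d a) d.+1 b)) (mkst o x (upd E d (a %/ b)))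
     (40 * M.+1 * M.+1).
Proof.
move=> E0 aM bM; set E1 := upd _ _ _.
set c := SSeq (incr d.+3) (copy d.+1 d.+2 d.+4).
set B := Pop d.+2.+3 (fun _ => Pop d.+2.+3 (fun a => Push d.+2.+3 a) c) Skip.
pose F i := upd (upd (upd E1 d (a - i)) d.+2 (b - i %% b)) d.+3 (i %/ b).
have H := @exb_loop d B a (fun _ => o) x F (5 * b + 5).
have Z i : d.+1 < i -> E1 i = 0 by move=> hi; rewrite /E1; upds; rewrite E0; lia.
have Ea : E1 d == a by apply/eqP; rewrite /E1; upds.
have Eb : E1 d.+1 == b by rewrite /E1 upd_eq.
have HB i : i < a -> exb B (mkst o x (upd (F i) d (a - i.+1))) (mkst o x (F i.+1)) (5 * b + 5).
  move=> hi; apply: (@exb_to _ _ _ _ (5 * b + 4).+1); [|done|by lia]; apply: exb_popr.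
  have -> : upd (F i) d (a - i.+1) d.+2 = b - i %% b by rewrite /F; upds.
  have [b0|b0] := posnP b.
    rewrite b0 modn0 sub0n; apply: exb_to (exb_skip _) _ _; last by lia.
    by congr mk; rewrite /F b0 !divn0 !sub0n; env_ext.
  have mb := ltn_pmod i b0.
  have -> : b - i %% b = (b - (i %% b).+1).+1 by lia.
  apply: (@exb_to _ _ _ _ (5 * b + 3).+1); [|done|by lia]; apply: exb_popr.
  rewrite upd_eq.
  have Ed := divnS i b0; have Em := modnS i b.
  case V: (b - (i %% b).+1) => [|v].
    have dv : b %| i.+1.
      by apply/eqP; rewrite -addn1 -modnDml addn1 (_ : (i %% b).+1 = b) ?modnn //; lia.
    rewrite dv /= in Ed Em.
    apply: exb_to (exb_seq (exb_incr _ _ _ _ _) (exb_copy _ _ _ _ _ _)) _ _; try lia.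
    + by rewrite /F; upds; rewrite Z; lia.
    + congr mk; rewrite /F Ed Em; env_ext; rewrite ?(eqP Eb); lia.
    + by rewrite /F; upds.
  have dv : ~~ (b %| i.+1).
    apply/negP => /eqP; rewrite -addn1 -modnDml addn1 modn_small; lia.
  rewrite (negbTE dv) /= in Ed Em.
  apply: exb_to (exb_incr _ _ _ _ _) _ _; last by lia.
  by congr mk; rewrite /F Ed Em; env_ext.
have HC : exb (copy d.+1 d.+2 d.+3) (mkst o x E1) (mkst o x (F 0)) (5 * b + 2).
  apply: exb_to (exb_copy _ _ _ _ _ _) _ _; rewrite ?(eqP Eb) ?Z //; try lia.
  by congr mk; rewrite /F subn0 mod0n subn0 div0n; env_ext; rewrite ?(eqP Ea) ?Z; lia.
have H1 := exb_seq HC (exb_seq (H _ HB)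
  (exb_seq (exb_clear _ _ _ d.+1) (exb_seq (exb_clear _ _ _ d.+2) (@exb_shift o x _ d.+3 d _)))).
apply: exb_to (H1 _ _) _ _.
- by move=> i _; rewrite /F; upds.
- lia.
- by congr mk; rewrite /F /E1; env_ext; rewrite ?E0 //; lia.
- have h : a %/ b <= a by apply: leq_div.
  rewrite /F /E1 /upd !eqxx !ifN; nia.
Qed.

Definition restore := Drain 2 (fun a => Push 1 a).

Lemma exb_restore o x y E : exb restore (mk o x y E) (mkst o (rev y ++ x) E) (2 * size y + 1).
Proof.
have H := @exb_drain 2 (fun a => Push 1 a) (fun i => mk o (rev (take i y) ++ x) (drop i y) E) y 1.
apply: exb_conv (H _ _) _ _ _ => //.
- move=> i hi; rewrite mk_set2; apply: exb_to (exb_push _ _ _) _ _ => //.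
  by rewrite mk_set1 (take_nth Zs) // rev_rcons.
- by rewrite take0 drop0.
- by rewrite take_size drop_size.
- by rewrite mulnC.
Qed.

Definition elen d := SSeq (Drain 1 (fun a => SSeq (incr d) (Push 2 a))) restore.

Lemma exb_elen o x E d : E d = 0 ->
  exb (elen d) (mkst o x E) (mkst o x (upd E d (size x))) (5 * size x + 2).
Proof.
move=> E0.
have H := @exb_drain 1 (fun a => SSeq (incr d) (Push 2 a))
  (fun i => mk o (drop i x) (rev (take i x)) (upd E d i)) x 2.
apply: exb_conv (exb_seq (H _ _) (exb_restore _ _ _ _)) _ _ _ => //.
- move=> i hi; rewrite mk_set1.
  apply: exb_to (exb_seq (exb_incr _ _ _ _ _) (exb_push _ _ _)) _ _ => //.
  by rewrite mk_set2 (take_nth Zs) // rev_rcons upd_eq upd_upd.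
- by rewrite take0 drop0 -[X in upd E d X]E0 upd_id.
- by rewrite take_size drop_size cats0 revK.
- by rewrite size_rev size_take_min minnn; lia.
Qed.

(** The first input symbol is on top of track 1, so [v] pops expose position [v]. Beyond the end
    there is nothing to pop and the result is 0. *)
Definition einp a d :=
  SSeq (loop d (Pop 1 (fun b => Push 2 b) Skip))
   (SSeq (Pop 1 (fun b => SSeq (Push 1 b) (if is_sym a (Some b) then incr d else Skip)) Skip)
     restore).

Lemma exb_einp o x E d a v : E d = 0 ->
  exb (einp a d) (mkst o x (upd E d v))
    (mkst o x (upd E d (is_sym a (nth None (map Some x) v)))) (3 * v + 2 * size x + 6).
Proof.
move=> E0.
have H := @exb_loop_mk d (Pop 1 (fun b => Push 2 b) Skip) v (fun _ => o)
  (fun i => drop i x) (fun i => rev (take i x)) (fun i => upd E d (v - i)) 2.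
set r : nat := is_sym _ _.
have HP : exb (Pop 1 (fun b => SSeq (Push 1 b) (if is_sym a (Some b) then incr d else Skip)) Skip)
   (mk o (drop v x) (rev (take v x)) (upd E d (v - v)))
   (mk o (drop v x) (rev (take v x)) (upd E d r)) 3.
  apply: exb_pop => /=; have [hv|hv] := ltnP v (size x).
    rewrite (drop_nth Zs) // /r (nth_map Zs) //; set b := nth _ _ _.
    rewrite mk_set1; apply: (exb_seq (n1 := 1) (n2 := 1) (exb_push _ _ _)); rewrite mk_set1 subnn.
    case: ifP => _; last exact: exb_skip.
    by apply: exb_to (exb_incr _ _ _ _ _) _ _; rewrite ?upd_upd ?upd_eq.
  rewrite drop_oversize // /r nth_default ?size_map //.
  by apply: exb_to (exb_skip _) _ _ => //; rewrite subnn; case: (a).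
have H1 := exb_seq (H _ _) (exb_seq HP (exb_restore _ _ _ _)).
apply: exb_conv (H1 _ _) _ _ _.
- by move=> i _; upds.
- move=> i hi; apply: exb_pop; rewrite upd_upd /=; have [hv|hv] := ltnP i (size x).
    rewrite (drop_nth Zs) // mk_set1; apply: exb_to (exb_push _ _ _) _ _ => //.
    by rewrite mk_set2 (take_nth Zs) // rev_rcons.
  rewrite drop_oversize //; apply: exb_to (exb_skip _) _ _ => //.
  by rewrite drop_oversize ?take_oversize //; lia.
- by rewrite take0 drop0 subn0.
- by rewrite revK cat_take_drop.
- rewrite size_rev size_take_min; lia.
Qed.

(** * Compilation with polynomial time bounds *)

Section Compile.
Variable d0 : nat.

Fixpoint cexpr (d : nat) (e : expr) : scmd :=
  match e with
  (* Tracks of variables from [d0] on may hold temporaries, but the environment of the expression is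
     0 there. *)
  | EVar k => if k < d0 then copy k d d.+1 else Skip
  | EConst c => iter c (SSeq (incr d)) Skip
  | ELen => elen d
  | EAdd a b => SSeq (cexpr d a) (SSeq (cexpr d.+1 b) (shift d.+1 d))
  | ESub a b => SSeq (cexpr d a) (SSeq (cexpr d.+1 b) (loop d.+1 (Pop d.+3 (fun _ => Skip) Skip)))
  | EMul a b => SSeq (cexpr d a) (SSeq (cexpr d.+1 b) (emul d))
  | EDiv a b => SSeq (cexpr d a) (SSeq (cexpr d.+1 b) (edivn d))
  | EInp a e => SSeq (cexpr d e) (einp a d)
  end.

Lemma exb_sub o x E d a b M : (forall i, d <= i -> E i = 0) -> b <= M ->
  exb (loop d.+1 (Pop d.+3 (fun _ => Skip) Skip))
    (mkst o x (upd (upd E d a) d.+1 b)) (mkst o x (upd E d (a - b))) (3 * M + 1).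
Proof.
move=> E0 bM.
have H := @exb_loop d.+1 (Pop d.+3 (fun _ => Skip) Skip) b (fun _ => o) x
  (fun i => upd (upd E d (a - i)) d.+1 (b - i)) 2.
apply: exb_conv (H _ _) _ _ _.
- by move=> i _; upds.
- move=> i hi; apply: exb_popr.
  have -> : upd (upd (upd E d (a - i)) d.+1 (b - i)) d.+1 (b - i.+1) d = a - i by upds.
  by case V: (a - i) => [|v]; apply: exb_to (exb_skip _) _ _ => //; congr mk; env_ext.
- by rewrite !subn0.
- by congr mk; env_ext; rewrite E0 //; lia.
- lia.
Qed.

(* [E0] is the environment of the expression; in [E] the temporaries above [d0] are added. *)
Definition computes (F : seq Sym -> env -> nat) (code : nat -> scmd) :=
  exists c k, forall o x E0 E d M,
    d0 <= d -> size x <= M -> (forall i, E i <= M) ->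
    (forall i, i < d0 -> E i = E0 i) -> (forall i, d0 <= i -> E0 i = 0) ->
    (forall i, d <= i -> E i = 0) ->
    F x E0 <= poly c k M /\ exb (code d) (mkst o x E) (mkst o x (upd E d (F x E0))) (poly c k M).

Lemma computes_bin f op cost A B ca cb :
  (forall a b M, a <= M -> b <= M -> op a b <= cost M) -> polyb cost ->
  (forall o x E d a b M, (forall i, d <= i -> E i = 0) -> a <= M -> b <= M ->
     exb (f d) (mkst o x (upd (upd E d a) d.+1 b)) (mkst o x (upd E d (op a b))) (cost M)) ->
  computes A ca -> computes B cb ->
  computes (fun x E => op (A x E) (B x E)) (fun d => SSeq (ca d) (SSeq (cb d.+1) (f d))).
Proof.
move=> hop [c3 [k3 h3]] hf [c1 [k1 h1]] [c2 [k2 h2]].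
(* The second operand is evaluated while variable [d] holds the value of the first, so its bound on
   the variables is [G M] instead of [M]. *)
pose G M := M + poly c1 k1 M.
pose H M := poly c1 k1 M + poly c2 k2 (G M).
have pH : polyb H :=
  polyb_add (polyb_poly c1 k1) (polyb_comp c2 k2 (polyb_add polyb_id (polyb_poly c1 k1))).
have [c [k hc]] := polyb_add pH (polyb_comp c3 k3 pH).
exists c, k => o x E0 E d M hd hx hE hE0 hz hd'.
have [v1 X1] := h1 o x E0 E d M hd hx hE hE0 hz hd'.
have [||||||v2 X2] := h2 o x E0 (upd E d (A x E0)) d.+1 (G M); rewrite /G.
- by lia.
- by lia.
- by move=> i; have := hE i; upds.
- by move=> i hi; rewrite -hE0 //; upds.
- by [].
- by move=> i hi; have := hd' i; upds.
have vb : B x E0 <= H M by rewrite /H; apply: leq_trans v2 _; apply: leq_addl.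
have va : A x E0 <= H M by rewrite /H; apply: leq_trans v1 _; apply: leq_addr.
split.
  apply: leq_trans (hop _ _ (H M) va vb) _; apply: leq_trans (h3 _) _.
  by apply: leq_trans (hc M); apply: leq_addl.
apply: exb_to (exb_seq X1 (exb_seq X2 (hf _ _ _ _ _ _ (H M) _ va vb))) _ _ => //.
by apply: leq_trans (hc M); rewrite addnA leq_add.
Qed.

Lemma computes_leaf F code cost : polyb cost ->
  (forall o x E0 E d M, d0 <= d -> size x <= M -> (forall i, E i <= M) ->
    (forall i, i < d0 -> E i = E0 i) -> (forall i, d0 <= i -> E0 i = 0) ->
    (forall i, d <= i -> E i = 0) ->
    F x E0 <= cost M /\ exb (code d) (mkst o x E) (mkst o x (upd E d (F x E0))) (cost M)) ->
  computes F code.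
Proof.
move=> [c [k h]] H; exists c, k => o x E0 E d M h1 h2 h3 h4 h5 h6.
have [le X] := H o x E0 E d M h1 h2 h3 h4 h5 h6.
by split; [apply: leq_trans (h M) | apply: exb_to X _ _].
Qed.

Lemma cexpr_ok e : computes (fun x E => eval x E e) (fun d => cexpr d e).
Proof.
have quad a : polyb (fun M => a * M.+1 * M.+1).
  have pS : polyb succn by exists 1, 1 => n; rewrite /poly mul1n expn1.
  by apply: polyb_mul (polyb_mul (polyb_const a) pS) pS.
elim: e => [k|c||a Ia b Ib|a Ia b Ib|a Ia b Ib|a Ia b Ib|a e [c [k h]]] /=.
- apply: (computes_leaf (quad 10)) => o x E0 E d M hd hx hE hE0 hz hd'.
  case: ltnP => hk; last by rewrite hz // -[X in upd _ _ X](hd' d) // upd_id; split;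
    [done | apply: exb_to (exb_skip _) _ _ => //; nia].
  have kM := hE k; rewrite -hE0 //; split; first by nia.
  apply: exb_to (exb_copy _ _ _ _ _ _) _ _; [lia|lia|lia| |by rewrite (hd' d)|by nia].
  by apply: hd'; lia.
- apply: (computes_leaf (polyb_const (c.+1))) => o x E0 E d M hd hx hE hE0 hz hd'.
  split; first by [].
  suff H E1 : exb (iter c (SSeq (incr d)) Skip) (mkst o x E1) (mkst o x (upd E1 d (E1 d + c))) c.+1.
    by apply: exb_to (H E) _ _; rewrite ?hd'.
  elim: c E1 => [|c IH] E1; first by rewrite addn0 upd_id; apply: exb_skip.
  by apply: exb_to (exb_seq (exb_incr _ _ _ _ _) (IH _)) _ _; rewrite ?upd_upd ?upd_eq ?addSnnS.
- apply: (computes_leaf (quad 10)) => o x E0 E d M hd hx hE hE0 hz hd'.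
  split; first by nia.
  by apply: exb_to (exb_elen _ _ _) _ _; rewrite ?hd' //; nia.
- apply: (computes_bin (f := fun d => shift d.+1 d) (op := addn) _ (quad 10)) Ia Ib.
    by move=> u v M; nia.
  move=> o x E d u v M E0 uM vM; apply: exb_to (exb_shift _ _ _ _) _ _; try lia.
    by congr mk; env_ext; rewrite E0 //; lia.
  by rewrite upd_eq; nia.
- apply: (computes_bin (f := fun d => loop d.+1 (Pop d.+3 (fun _ => Skip) Skip)) (op := subn)
    _ (quad 10)) Ia Ib => [u v M|o x E d u v M E0 uM vM]; first by nia.
  by apply: exb_to (exb_sub _ _ _ E0 vM) _ _ => //; nia.
- apply: (computes_bin (op := muln) _ (quad 20)) Ia Ib => [u v M uM vM|*]; last exact: exb_emul.
  by have := leq_mul uM vM; nia.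
- apply: (computes_bin (op := divn) _ (quad 40)) Ia Ib => [u v M uM vM|*]; last exact: exb_edivn.
  by have := leq_div u v; nia.
- pose H M := 5 * poly c k M + 2 * M + 6.
  have pH : polyb H := polyb_add (polyb_add (polyb_mul (polyb_const 5) (polyb_poly c k))
    (polyb_mul (polyb_const 2) polyb_id)) (polyb_const 6).
  apply: (computes_leaf pH) => o x E0 E d M hd hx hE hE0 hz hd'.
  have [v X] := h o x E0 E d M hd hx hE hE0 hz hd'.
  split; first by rewrite /H; case: is_sym; lia.
  apply: exb_to (exb_seq X (@exb_einp o x E d a _ (hd' d (leqnn d)))) _ _ => //.
  by rewrite /H; lia.
Qed.

End Compile.

Fixpoint cgen (d : nat) (g : gen) : scmd :=
  match g with
  | GEmit a => Push 0 a
  | GSeq g1 g2 => SSeq (cgen d g1) (cgen d g2)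
  | GIf e g1 g2 =>
      SSeq (cexpr d d e) (Pop d.+3 (fun _ => SSeq (clear d) (cgen d g1)) (cgen d g2))
  | GFor e g =>
      SSeq (cexpr d d e) (SSeq (loop d (SSeq (cgen d.+2 g) (incr d.+1))) (clear d.+1))
  end.

(** Emitting is pushing on track 0, which reverses the output as a list; on the tape, where stacks
    are stored bottom first, it stands in order of emission. The time bound does not depend on the
    output [o] already present. *)
Lemma cgen_ok g d : exists c k, forall o x E M,
  size x <= M -> (forall i, E i <= M) -> (forall i, d <= i -> E i = 0) ->
  exb (cgen d g) (mkst o x E) (mkst (rev (gout x d E g) ++ o) x E) (poly c k M).
Proof.
elim: g d => [a|g1 I1 g2 I2|e g1 I1 g2 I2|e g I] d.
- exists 1, 0 => o x E M hx hE hd.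
  by apply: exb_to (exb_push _ _ _) _ _; rewrite ?mk_set0.
- have [c1 [k1 h1]] := I1 d; have [c2 [k2 h2]] := I2 d.
  have [c [k hc]] := polyb_add (polyb_poly c1 k1) (polyb_poly c2 k2).
  exists c, k => o x E M hx hE hd.
  have X2 := h2 (rev (gout x d E g1) ++ o) x E M hx hE hd.
  by apply: exb_to (exb_seq (h1 o x E M hx hE hd) X2) _ _; rewrite //= rev_cat catA.
- have [c1 [k1 h1]] := I1 d; have [c2 [k2 h2]] := I2 d; have [c0 [k0 h0]] := cexpr_ok d e.
  have [c [k hc]] := polyb_add (polyb_poly c0 k0) (polyb_add (polyb_add
    (polyb_poly c0 k0) (polyb_add (polyb_poly c0 k0) (polyb_const 2)))
    (polyb_add (polyb_poly c1 k1) (polyb_poly c2 k2))).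
  exists c, k => o x E M hx hE hd.
  have [v X] := h0 o x E E d M (leqnn d) hx hE (fun _ _ => erefl) hd hd.
  apply: exb_to (exb_seq X (exb_popr (n := 2 * poly c0 k0 M + 1 + poly c1 k1 M + poly c2 k2 M) _)) _ _ => //=;
    last by apply: leq_trans (hc M); lia.
  rewrite upd_eq; case V: (eval x E e) v => [|v] vle.
    by rewrite -[X in upd E d X](hd d) // upd_id; apply: exb_to (h2 _ _ _ _ hx hE hd) _ _ => //; lia.
  rewrite upd_upd; apply: exb_to (exb_seq (exb_clear _ _ _ _) _) _ _.
  + rewrite upd_upd -[X in upd E d X](hd d) // upd_id; exact: h1 hx hE hd.
  + by [].
  + by rewrite upd_eq; lia.
- have [c1 [k1 h1]] := I d.+2; have [c0 [k0 h0]] := cexpr_ok d e.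
  pose G M := M + poly c0 k0 M.
  have pG : polyb G := polyb_add polyb_id (polyb_poly c0 k0).
  have [c [k hc]] := polyb_add (polyb_poly c0 k0) (polyb_add (polyb_mul (polyb_poly c0 k0)
    (polyb_add (polyb_comp c1 k1 pG) (polyb_const 4))) (polyb_const 3)).
  exists c, k => o x E M hx hE hd.
  have [vle X] := h0 o x E E d M (leqnn d) hx hE (fun _ _ => erefl) hd hd.
  set v := eval x E e in vle X; rewrite /= -/v.
  pose F i := gout x d.+2 (upd (upd E d (v - i.+1)) d.+1 i) g.
  have H := @exb_loop d (SSeq (cgen d.+2 g) (incr d.+1)) v
    (fun i => rev (flatten [seq F j | j <- iota 0 i]) ++ o) x
    (fun i => upd (upd E d (v - i)) d.+1 i) (poly c1 k1 (G M) + 1).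
  have X1 : exb (loop d (SSeq (cgen d.+2 g) (incr d.+1))) (mkst o x (upd E d v))
     (mkst (rev (flatten [seq F j | j <- iota 0 v]) ++ o) x (upd E d.+1 v))
     (v * (poly c1 k1 (G M) + 1).+1 + 1).
    apply: exb_conv (H _ _) _ _ _ => //.
    + by move=> i _; upds.
    + move=> i hi.
      have -> : upd (upd (upd E d (v - i)) d.+1 i) d (v - i.+1) = upd (upd E d (v - i.+1)) d.+1 i.
        by env_ext.
      apply: exb_to (exb_seq (h1 _ _ _ (G M) _ _ _) (exb_incr _ _ _ _ _)) _ _ => //.
      * by rewrite /G; lia.
      * by move=> j; rewrite /G; have := hE j; upds.
      * by move=> j hj; have := hd j; upds.
      * rewrite -/(F i) -[in RHS]addn1 iotaD map_cat flatten_cat rev_cat /= cats0 catA.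
        by congr mk; env_ext.
    + by rewrite subn0 /=; congr mk; env_ext; rewrite hd //; lia.
    + by rewrite subnn; congr mk; env_ext; rewrite hd //; lia.
  apply: exb_to (exb_seq X (exb_seq X1 (exb_clear _ _ _ _))) _ _.
    by rewrite upd_upd; congr mk; env_ext; rewrite hd //; lia.
  rewrite upd_eq; apply: leq_trans (hc M); rewrite leq_add2l.
  have := leq_mul vle (leqnn (poly c1 k1 (G M) + 4)); lia.
Qed.

(* A machine starts on cell 1, with its input on track 0; the simulated programs start on cell 0
   and read their input from track 1. *)
Definition gprog k g :=
  Seq (Act id MLeft) (Seq (sim k (SSeq (Drain 0 (fun a => Push 1 a)) (cgen 0 g))) (Act id MRight)).

Theorem gen_poly_time g : exists (M : TM) c e, forall x, exists n,
  [/\ n <= poly c e (size x), halted (run M n x)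
    & output (run M n x) = gout x 0 (fun _ => 0) g].
Proof.
set code := SSeq (Drain 0 (fun a => Push 1 a)) (cgen 0 g).
have [k hk] := tracks_le_ex code; have [c1 [k1 h1]] := cgen_ok g 0.
pose T n := 2 * n + 1 + poly c1 k1 n.
have pT : polyb T :=
  polyb_add (polyb_add (polyb_mul (polyb_const 2) polyb_id) (polyb_const 1)) (polyb_poly c1 k1).
have pn : polyb (fun n => 2 + T n * (k.+4 * (2 * (n + T n) + 20))) :=
  polyb_add (polyb_const 2) (polyb_mul pT (polyb_mul (polyb_const k.+4)
    (polyb_add (polyb_mul (polyb_const 2) (polyb_add polyb_id pT)) (polyb_const 20)))).
have [c [e hc]] := pn; exists (mach (gprog k g)), c, e => x.
(* The input written from cell 1 on represents the stack [rev x]; draining it into track 1 puts the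
   first symbol of [x] on top. *)
pose S0 : store := fun j => if j is 0 then rev x else [::].
have X0 : exb (Drain 0 (fun a => Push 1 a)) S0 (mkst [::] x (fun _ => 0)) (size x * 2 + 1).
  have H := @exb_drain 0 (fun a => Push 1 a)
    (fun i => mkst (drop i (rev x)) (rev (take i (rev x))) (fun _ => 0)) (rev x) 1.
  apply: exb_conv (H _ _) _ _ _ => //.
  - move=> i hi; rewrite mk_set0; apply: exb_to (exb_push _ _ _) _ _ => //.
    by rewrite mk_set1 (take_nth Zs) // rev_rcons.
  - by apply: functional_extensionality => -[|[|[|j]]] //=; rewrite ?take0 ?drop0.
  - by rewrite take_size drop_size revK.
  - by rewrite size_rev.
have [n nT X] := exb_seq X0 (h1 [::] x (fun _ => 0) (size x) (leqnn _) (fun _ => leq0n _) (fun _ _ => erefl)).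
pose f0 : ftape := fun z => if z is Posz i.+1 then nth None (map Some x) i else None.
have R0 : rep k S0 f0.
  split=> //; last by exists 0; [case | move=> b; rewrite /hdr mulSn; case: (_ + _)].
  move=> [|j] b hj /=; first by rewrite revK.
  by rewrite nth_nil; case E: (_ + _) => // [m]; lia.
have hm j : size (S0 j) <= size x by case: j => //=; rewrite size_rev.
have [f' [_ R' _] V] := exec_sim X hk hm R0.
have E1 : ev (gprog k g) 1%R f0 1%R f' (poly c e (size x)).
  have A1 := ev_act id MLeft 1%R f0; rewrite fset_id in A1.
  have A2 := ev_act id MRight 0%R f'; rewrite fset_id in A2.
  apply: ev_le (ev_seq A1 (ev_seq V A2)).
  apply: leq_trans (hc _); have nT' : n <= T (size x) by rewrite /T [2 * _]mulnC.
  have := leq_mul nT' (unit_cost_le k 1 (leq_add (leqnn (size x)) nT')).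
  by rewrite !mul1n {2}/unit_cost; lia.
have [|||m H] := @ev_mach (gprog k g) x f0 1%R f' _ (gout x 0 (fun _ => 0) g) _ _ E1 _.
- by [].
- by case.
- move=> i; rewrite (_ : 1 + i%:Z = addr k 0 i)%R; last by rewrite /=; lia.
  by rewrite R' //= cats0 revK.
by exists m.
Qed.

(** * Generating a table of bits *)

Definition exprable (f : seq Sym -> env -> nat) := exists e, forall x E, eval x E e = f x E.

Lemma ex_ext f g : exprable f -> (forall x E, f x E = g x E) -> exprable g.
Proof. by move=> [e H] fg; exists e => x E; rewrite H fg. Qed.

Lemma ex_var k : exprable (fun _ E => E k).
Proof. by exists (EVar k). Qed.

Lemma ex_const c : exprable (fun _ _ => c).
Proof. by exists (EConst c). Qed.

Lemma ex_len : exprable (fun x _ => size x).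
Proof. by exists ELen. Qed.

Lemma ex_add f g : exprable f -> exprable g -> exprable (fun x E => f x E + g x E).
Proof. by move=> [a Ha] [b Hb]; exists (EAdd a b) => x E /=; rewrite Ha Hb. Qed.

Lemma ex_sub f g : exprable f -> exprable g -> exprable (fun x E => f x E - g x E).
Proof. by move=> [a Ha] [b Hb]; exists (ESub a b) => x E /=; rewrite Ha Hb. Qed.

Lemma ex_mul f g : exprable f -> exprable g -> exprable (fun x E => f x E * g x E).
Proof. by move=> [a Ha] [b Hb]; exists (EMul a b) => x E /=; rewrite Ha Hb. Qed.

Lemma ex_div f g : exprable f -> exprable g -> exprable (fun x E => f x E %/ g x E).
Proof. by move=> [a Ha] [b Hb]; exists (EDiv a b) => x E /=; rewrite Ha Hb. Qed.

Lemma ex_sym a f : exprable f -> exprable (fun x E => is_sym a (nth None (map Some x) (f x E)) : nat).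
Proof. by move=> [e H]; exists (EInp a e) => x E /=; rewrite H. Qed.

Lemma ex_mod f g : exprable f -> exprable g -> exprable (fun x E => f x E %% g x E).
Proof.
move=> hf hg; apply: ex_ext (ex_sub hf (ex_mul (ex_div hf hg) hg)) _ => x E.
by rewrite {1}(divn_eq (f x E) (g x E)) addKn.
Qed.

Lemma ex_succ f : exprable f -> exprable (fun x E => (f x E).+1).
Proof. by move=> hf; apply: ex_ext (ex_add hf (ex_const 1)) _ => x E; rewrite addn1. Qed.

Lemma ex_pow f k : exprable f -> exprable (fun x E => f x E ^ k).
Proof.
move=> hf; elim: k => [|k IH]; first exact: ex_const.
by apply: ex_ext (ex_mul hf IH) _ => x E; rewrite expnS.
Qed.

Lemma ex_neg (f : seq Sym -> env -> bool) : exprable (fun x E => f x E : nat) -> exprable (fun x E => ~~ f x E : nat).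
Proof. by move=> hf; apply: ex_ext (ex_sub (ex_const 1) hf) _ => x E; case: (f x E). Qed.

Lemma ex_and (f g : seq Sym -> env -> bool) : exprable (fun x E => f x E : nat) -> exprable (fun x E => g x E : nat) ->
  exprable (fun x E => f x E && g x E : nat).
Proof. by move=> hf hg; apply: ex_ext (ex_mul hf hg) _ => x E; case: (f x E); case: (g x E). Qed.

Lemma ex_or (f g : seq Sym -> env -> bool) : exprable (fun x E => f x E : nat) -> exprable (fun x E => g x E : nat) ->
  exprable (fun x E => f x E || g x E : nat).
Proof.
move=> hf hg; apply: ex_ext (ex_neg (ex_and (ex_neg hf) (ex_neg hg))) _ => x E.
by rewrite -negb_or negbK.
Qed.

Lemma ex_if (b : seq Sym -> env -> bool) f g : exprable (fun x E => b x E : nat) -> exprable f -> exprable g ->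
  exprable (fun x E => if b x E then f x E else g x E).
Proof.
move=> hb hf hg; apply: ex_ext (ex_add (ex_mul hb hf) (ex_mul (ex_neg hb) hg)) _ => x E.
by case: (b x E); rewrite ?mul0n ?mul1n ?addn0.
Qed.

Lemma ex_ifb (b f g : seq Sym -> env -> bool) : exprable (fun x E => b x E : nat) -> exprable (fun x E => f x E : nat) ->
  exprable (fun x E => g x E : nat) ->
  exprable (fun x E => (if b x E then f x E else g x E) : nat).
Proof. by move=> hb hf hg; apply: ex_ext (ex_if hb hf hg) _ => x E; case: (b x E). Qed.

Lemma ex_leq f g : exprable f -> exprable g -> exprable (fun x E => f x E <= g x E : nat).
Proof.
move=> hf hg; apply: ex_ext (ex_sub (ex_const 1) (ex_sub hf hg)) _ => x E.
by rewrite /leq; case: (f x E - g x E) => [|[]].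
Qed.

Lemma ex_eq f g : exprable f -> exprable g -> exprable (fun x E => f x E == g x E : nat).
Proof.
by move=> hf hg; apply: ex_ext (ex_and (ex_leq hf hg) (ex_leq hg hf)) _ => x E; rewrite eqn_leq.
Qed.

(** A lookup in a list that does not depend on the input is a finite case distinction. The cell
    values and clause kinds of the verifier enter expressions in this way. *)
Lemma ex_table (I : Type) (i0 : I) (s : seq I) (F : I -> seq Sym -> env -> nat) g :
  exprable g -> (forall i, exprable (F i)) ->
  exprable (fun x E => F (nth i0 s (g x E)) x E).
Proof.
move=> hg hF; elim: s => [|i s IH] in g hg *.
  by apply: ex_ext (hF i0) _ => x E; rewrite nth_nil.
have hg1 : exprable (fun x E => g x E - 1) by apply: ex_sub hg (ex_const 1).
apply: ex_ext (ex_if (ex_eq hg (ex_const 0)) (hF i) (IH _ hg1)) _ => x E.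
by case: (g x E) => [|k] //=; rewrite subn1.
Qed.

Lemma ex_tableb (I : Type) (i0 : I) (s : seq I) (F : I -> seq Sym -> env -> bool) g :
  exprable g -> (forall i, exprable (fun x E => F i x E : nat)) ->
  exprable (fun x E => F (nth i0 s (g x E)) x E : nat).
Proof. by move=> hg hF; apply: (@ex_table _ i0 s (fun i x E => F i x E : nat)). Qed.

Lemma bits_mkseq f n : bits (mkseq f n) = [seq if f i then Os else Zs | i <- iota 0 n].
Proof. by rewrite /bits /mkseq -map_comp. Qed.

Lemma flatten_seq1 (T S : Type) (f : T -> S) s : flatten [seq [:: f i] | i <- s] = map f s.
Proof. by elim: s => //= i s ->. Qed.

Section DataGenerator.
Variables (C K T m : seq Sym -> nat) (p : seq Sym -> nat -> bool)
  (b : seq Sym -> nat -> nat -> bool).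
Hypotheses (exC : exprable (fun x _ => C x)) (exK : exprable (fun x _ => K x))
  (exT : exprable (fun x _ => T x)) (exm : exprable (fun x _ => m x))
  (ex_p : exprable (fun x E => p x (E 1) : nat))
  (ex_b : exprable (fun x E => b x (E 1) (E 3) : nat)).

Definition table_data x :=
  EVData (C x) (K x) (mkseq (p x) (T x)) (mkseq (fun u => mkseq (b x u) (T x)) (m x)).

Lemma table_data_wf x : data_wf (table_data x).
Proof. by apply/allP => a /mapP [u _ ->]; rewrite /= !size_mkseq. Qed.

Lemma table_data_poly_time : exists (M : TM) c e, forall x, exists n,
  [/\ n <= poly c e (size x), halted (run M n x)
    & output (run M n x) = enc_ev (table_data x)].
Proof.
have [eC hC] := exC; have [eK hK] := exK; have [eT hT] := exT; have [em hm] := exm.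
have [ep hp] := ex_p; have [eb hb] := ex_b.
(* An outermost loop has its index in variable 1 and a loop nested in it in variable 3: the vehicle
   is [E 1] and the time [E 3], while in the row of rewards the time is [E 1]. *)
pose row := GSeq (GFor eT (GIf eb (GEmit Os) (GEmit Zs))) (GEmit Ss).
pose g := GSeq (GFor eC (GEmit Os)) (GSeq (GEmit Ss) (GSeq (GFor eK (GEmit Os)) (GSeq (GEmit Ss)
  (GSeq (GFor eT (GIf ep (GEmit Os) (GEmit Zs))) (GSeq (GEmit Ss) (GFor em row)))))).
have [M [c [e H]]] := gen_poly_time g; exists M, c, e => x; have [n [h1 h2 h3]] := H x.
exists n; split=> //; rewrite h3 /g /row /enc_ev /table_data /=.
have bit (v : bool) : (match v : nat with 0 => [:: Zs] | _.+1 => [:: Os] end) =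
  [:: if v then Os else Zs] by case: v.
have nsq v : flatten [seq [:: Os] | _ <- iota 0 v] = nseq v Os.
  by rewrite flatten_seq1; elim: v 0 => //= v IH a; rewrite IH.
rewrite hC hK hT hm !nsq; congr (_ ++ Ss :: _ ++ Ss :: _ ++ Ss :: flatten _).
  rewrite bits_mkseq -[RHS]flatten_seq1; congr flatten.
  by apply: eq_map => i; rewrite hp bit.
rewrite /mkseq -map_comp; apply: eq_map => u; rewrite /= hT; congr (_ ++ _).
rewrite bits_mkseq -[RHS]flatten_seq1; congr flatten.
by apply: eq_map => i; rewrite hb bit.
Qed.

End DataGenerator.

(** * Unique readability of encoded instances *)

Lemma bits_inj a b r r' : bits a ++ Ss :: r = bits b ++ Ss :: r' -> a = b /\ r = r'.
Proof.
elim: a b => [|u a IH] [|v b] //=; try by [case: u | case: v].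
  by case.
by case: u; case: v => //= -[] /IH [-> ->].
Qed.

Lemma flatten_bits_inj s s' :
  flatten [seq bits a ++ [:: Ss] | a <- s] = flatten [seq bits a ++ [:: Ss] | a <- s'] -> s = s'.
Proof.
elim: s s' => [|a s IH] [|b s'] //=; try by [case: a => [|[]] | case: b => [|[]]].
by rewrite -!catA /= => /bits_inj [-> /IH ->].
Qed.

(** The language asks for some instance with the given encoding, so a negative answer for one
    instance must exclude all others with the same word. Unary numbers are read as bit strings of
    ones, and [Ss] ends each field since [bits] never produces it. *)
Lemma enc_ev_inj : injective enc_ev.
Proof.
move=> [C K p av] [C' K' p' av']; rewrite /enc_ev /=.
have E n : nseq n Os = bits (nseq n true) by elim: n => //= n ->.
rewrite !E => /bits_inj [hC] /bits_inj [hK] /bits_inj [-> /flatten_bits_inj ->].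
by rewrite -(size_nseq C true) hC size_nseq -(size_nseq K true) hK size_nseq.
Qed.

(** * From satisfiability to vehicle scheduling *)

(** A schedule collecting every reward, as a function from rewarded times to vehicles. Times are
    counted from 0 here and from 1 in the instance. *)
Definition slot_filling (d : ev_data) (g : nat -> nat) : Prop :=
  (forall k, nth false (d_p d) k -> g k < size (d_av d) /\ nth false (nth [::] (d_av d) (g k)) k) /\
  (forall k k', k < k' -> nth false (d_p d) k -> nth false (d_p d) k' -> g k = g k' ->
     k + d_C d < k').

Lemma count_nth_iota (p : seq bool) : count (nth false p) (iota 0 (size p)) = count id p.
Proof. by rewrite -[p in RHS](mkseq_nth false) /mkseq count_map; apply: eq_count. Qed.

Lemma nth_false_size (p : seq bool) k : nth false p k -> k < size p.
Proof. by case: ltnP => // h; rewrite nth_default. Qed.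

(* When the threshold is the number of rewarded times, all of them must be served. *)
Lemma decisionP (d : ev_data) : d_K d = count id (d_p d) ->
  ev_decision (of_data d) ((d_K d)%:R)%R <-> exists g, slot_filling d g.
Proof.
move=> hK; split.
  case=> S [[uS hS h1 h2]]; rewrite /total_reward /= -natr_sum ler_nat => hle.
  pose r (s : triple) := nth false (d_p d) (tr_t s).-1.
  pose ts := [seq (tr_t s).-1 | s <- S & r s].
  pose ks := [seq k <- iota 0 (size (d_p d)) | nth false (d_p d) k].
  have tS s : s \in S -> tr_t s = (tr_t s).-1.+1 by case/hS => _ _ /andP[]; case: (tr_t s).
  have jS s : s \in S -> tr_j s = 0 by case/hS => _ /=; case: (tr_j s).
  have uts : uniq ts.
    rewrite map_inj_in_uniq ?filter_uniq // => s s'; rewrite !mem_filter => /andP[_ sS] /andP[_ sS'] E.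
    by apply: h1; rewrite ?jS // (tS _ sS) (tS _ sS') E.
  have sub : {subset ts <= ks}.
    move=> k /mapP[s]; rewrite mem_filter => /andP[rs sS] ->.
    by rewrite mem_filter mem_iota /= -/(r s) rs (nth_false_size rs).
  have hsz : size ks <= size ts.
    rewrite size_map !size_filter count_nth_iota -hK; apply: leq_trans hle _.
    by rewrite -sum1_count [X in _ <= X]big_mkcond; apply: leq_sum => s _; rewrite /r; case: nth.
  (* With a single station the served times are distinct; being at least as many as the rewarded
     ones, they exhaust them. *)
  have [_ mts] := uniq_min_size uts sub hsz.
  pose f k := nth (0, 0, 0) S (find (fun s => (tr_t s).-1 == k) S).
  have fP k : nth false (d_p d) k -> f k \in S /\ tr_t (f k) = k.+1.
    move=> hk; have : k \in ts by rewrite mts mem_filter hk mem_iota nth_false_size.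
    case/mapP => s; rewrite mem_filter => /andP[_ sS] Ek.
    have hs : has (fun s => (tr_t s).-1 == k) S by apply/hasP; exists s; rewrite ?Ek.
    have fS : f k \in S by rewrite mem_nth // -has_find.
    split=> //; rewrite (tS _ fS); congr succn; apply/eqP.
    exact: (nth_find (0, 0, 0) hs).
  exists (fun k => tr_i (f k)); split=> [k /fP [fS Et]|k k' kk /fP [fS Et] /fP [fS' Et'] E].
    by have [hi _ _] := hS _ fS; rewrite /= Et.
  have := h2 _ _ fS fS' _ E; rewrite /= Et Et' => H.
  have /H : f k <> f k' by move=> e; move: Et; rewrite e Et'; lia.
  by lia.
case=> g [h1 h2].
pose ks := [seq k <- iota 0 (size (d_p d)) | nth false (d_p d) k].
exists [seq (g k, 0, k.+1) | k <- ks]; split.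
  have ksP k : k \in ks -> nth false (d_p d) k by rewrite mem_filter => /andP[].
  split.
  - by rewrite map_inj_uniq ?filter_uniq ?iota_uniq // => k k' [].
  - by move=> s /mapP[k /ksP hk ->]; have [] := h1 k hk; split=> //=; apply: nth_false_size.
  - by move=> s s' /mapP[k hk ->] /mapP[k' hk' ->] _ [->].
  - move=> s s' /mapP[k /ksP hk ->] /mapP[k' /ksP hk' ->] /= ne E.
    case: (ltngtP k k') => [kk|kk|kk]; last by case: ne; rewrite kk.
    + by have := h2 _ _ kk hk hk' E; rewrite /tr_t /=; lia.
    + by have := h2 _ _ kk hk' hk (esym E); rewrite /tr_t /=; lia.
rewrite /total_reward /= -natr_sum ler_nat big_map /= hK -count_nth_iota -size_filter -/ks.
rewrite -sum1_size [X in _ <= X]big_seq_cond [X in X <= _]big_seq_cond.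
by apply: leq_sum => k; rewrite mem_filter => /andP[/andP[]]; rewrite /tr_t /= => ->.
Qed.

Section CNF.
Variables (nv ncl : nat) (lit : nat -> bool -> nat -> bool).
Hypotheses (nv_gt0 : 0 < nv) (ncl_gt0 : 0 < ncl).

Definition sat := exists a : nat -> bool,
  forall c, c < ncl -> exists2 v, v < nv & lit v (a v) c.

(* One copy of every variable per clause.  Vehicle [(v * ncl + c) * 2 + s] is the literal of sign
   [s] of copy [c] of variable [v]; it can serve up to two times, provided that these lie in the
   first and the last of the five stretches of times.  The middle stretch uses up one literal of
   each copy, which thereby becomes false.  The first stretch is the cyclic chain of implications
   between the copies, copy [c] implying copy [c + 1], and the last one the clauses. *)
Let B := nv * ncl.

(** The idle stretches tune the distances to the charging time [B * 3]. Times of the first and last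
    stretch differ by at least [B * 4 - (B - 1)]. Any other two rewarded times differ by less than
    [B * 3]; for the middle and last stretch this uses [ncl <= B]. *)
Definition cnf_p (k : nat) : bool := [|| k < B, (B * 2 <= k) && (k < B * 3) | B * 4 <= k].

(** Slot [v * ncl + c] of the first stretch accepts the negative literal of copy [c] and the
    positive one of the cyclically next copy, which is the implication as a disjunction. Each
    vehicle is available at only one slot of each rewarded stretch. *)
Definition cnf_av (u k : nat) : bool :=
  if k < B then
    (k %/ ncl == u %/ 2 %/ ncl) &&
    (u %/ 2 %% ncl == if odd u then (k %% ncl).+1 %% ncl else k %% ncl)
  else if k < B * 3 then (B * 2 <= k) && (k - B * 2 == u %/ 2)
  else (B * 4 <= k) && (u %/ 2 %% ncl == k - B * 4) && lit (u %/ 2 %/ ncl) (odd u) (u %/ 2 %% ncl).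

Definition cnf_data := EVData (B * 3) (B * 2 + ncl) (mkseq cnf_p (B * 4 + ncl))
  (mkseq (fun u => mkseq (cnf_av u) (B * 4 + ncl)) (B * 2)).

Lemma cnf_K : d_K cnf_data = count id (d_p cnf_data).
Proof.
rewrite /= /mkseq count_map (_ : B * 4 + ncl = B + (B + (B + (B + ncl)))); last lia.
have H b m n : (forall i, m <= i < m + n -> cnf_p i = b) -> count (preim cnf_p id) (iota m n) = b * n.
  move=> h; rewrite -[in RHS](size_iota m n); case: b h => h; rewrite ?mul1n ?mul0n.
    by apply/eqP; rewrite -all_count; apply/allP => i; rewrite mem_iota => /h.
  by apply/eqP; rewrite -leqn0 leqNgt -has_count; apply/hasPn => i; rewrite mem_iota => /h /= ->.
rewrite !iotaD !count_cat !add0n.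
rewrite (H true 0) ?(H false B) ?(H true (B + B)) ?(H false (B + B + B)) ?(H true (B + B + B + B));
  rewrite /cnf_p; lia.
Qed.

Lemma nth_cnf_p k : nth false (d_p cnf_data) k = (k < B * 4 + ncl) && cnf_p k.
Proof. by rewrite /=; case: ltnP => h; [rewrite nth_mkseq | rewrite nth_default ?size_mkseq]. Qed.

Lemma nth_cnf_av u k : u < B * 2 -> k < B * 4 + ncl ->
  nth false (nth [::] (d_av cnf_data) u) k = cnf_av u k.
Proof. by move=> hu hk; rewrite /= nth_mkseq // nth_mkseq. Qed.

Let code v c (s : bool) := (v * ncl + c) * 2 + s.

Lemma code_div v c s : code v c s %/ 2 = v * ncl + c.
Proof. by rewrite /code divnMDl // (divn_small (m := s)) ?addn0 //; case: s. Qed.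

Lemma code_odd v c s : odd (code v c s) = s.
Proof. by rewrite /code oddD oddM andbF; case: s. Qed.

Lemma code_lt v c s : v < nv -> c < ncl -> code v c s < B * 2.
Proof. by move=> hv hc; rewrite /code /B; have := leq_mul hv (leqnn ncl); case: s; nia. Qed.

Lemma ncl_le : ncl <= B. Proof. by rewrite /B leq_pmull. Qed.

Lemma pair_div v c : c < ncl -> (v * ncl + c) %/ ncl = v.
Proof. by move=> hc; rewrite divnMDl // divn_small ?addn0. Qed.

Lemma pair_mod v c : c < ncl -> (v * ncl + c) %% ncl = c.
Proof. by move=> hc; rewrite modnMDl modn_small. Qed.

Lemma modS_inj c c' : c < ncl -> c' < ncl -> c.+1 %% ncl = c'.+1 %% ncl -> c = c'.
Proof.
move=> hc hc'; case: (ltngtP c.+1 ncl) hc => // [h|h] _; case: (ltngtP c'.+1 ncl) hc' => // [h'|h'] _.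
- by rewrite !modn_small //; lia.
- by rewrite h' modnn modn_small.
- by rewrite h modnn modn_small.
- by lia.
Qed.

(** The middle stretch takes the false literal of every copy and the outer ones only true literals.
    A vehicle used twice thus serves in the first and in the last stretch, which are far enough
    apart. *)
Lemma sat_filling : sat -> exists g, slot_filling cnf_data g.
Proof.
case=> a ha.
pose wit c := find (fun v => lit v (a v) c) (iota 0 nv).
have witP c : c < ncl -> wit c < nv /\ lit (wit c) (a (wit c)) c.
  move=> hc; have [v hv L] := ha c hc.
  have hs : has (fun v => lit v (a v) c) (iota 0 nv) by apply/hasP; exists v; rewrite ?mem_iota.
  have lw : wit c < nv by rewrite -[X in _ < X](size_iota 0 nv) -has_find.
  by split=> //; have := nth_find 0 hs; rewrite nth_iota.
pose g k :=
  if k < B then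
    if a (k %/ ncl) then code (k %/ ncl) ((k %% ncl).+1 %% ncl) true
    else code (k %/ ncl) (k %% ncl) false
  else if k < B * 3 then code ((k - B * 2) %/ ncl) ((k - B * 2) %% ncl) (~~ a ((k - B * 2) %/ ncl))
  else code (wit (k - B * 4)) (k - B * 4) (a (wit (k - B * 4))).
have gE k : nth false (d_p cnf_data) k -> exists v c s,
   [/\ g k = code v c s, v < nv, c < ncl &
    [\/ [/\ k < B, s = a v, k %/ ncl = v & c = if s then (k %% ncl).+1 %% ncl else k %% ncl],
        [/\ B * 2 <= k < B * 3, s = ~~ a v & k = B * 2 + (v * ncl + c)] |
        [/\ k = B * 4 + c, s = a v & lit v s c]]].
  rewrite nth_cnf_p => /andP[hk hp]; rewrite /g; case: ltnP => h1.
    have hv : k %/ ncl < nv by rewrite ltn_divLR.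
    case E: (a _); do 3 eexists; split; try reflexivity; rewrite ?ltn_pmod //;
      by constructor 1; rewrite E.
  case: ltnP => h2.
    have hv : (k - B * 2) %/ ncl < nv by rewrite ltn_divLR //; rewrite /B in h2 *; lia.
    do 3 eexists; split; try reflexivity; rewrite ?ltn_pmod //; constructor 2; split=> //.
      by move: hp; rewrite /cnf_p; lia.
    by rewrite -divn_eq; move: hp; rewrite /cnf_p; lia.
  have h4 : B * 4 <= k by move: hp; rewrite /cnf_p; lia.
  have hc : k - B * 4 < ncl by lia.
  have [w1 w2] := witP _ hc.
  by do 3 eexists; split; try reflexivity; rewrite //; constructor 3; rewrite subnKC.
have cE v c s v' c' s' : c < ncl -> c' < ncl -> code v c s = code v' c' s' -> [/\ v = v', c = c' & s = s'].
  move=> hc hc' E; have := congr1 odd E; rewrite !code_odd => ->.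
  have := congr1 (divn^~ 2) E; rewrite !code_div => Ed.
  split=> //; first by rewrite -(pair_div v hc) Ed pair_div.
  by rewrite -(pair_mod v hc) Ed pair_mod.
have B1 := ncl_le.
exists g; split.
  move=> k hk; have [v [c [s [E hv hc H]]]] := gE k hk.
  rewrite E size_mkseq; split; first exact: code_lt.
  move: hk; rewrite nth_cnf_p => /andP[hk hp]; rewrite nth_cnf_av ?code_lt // /cnf_av.
  rewrite code_div code_odd pair_div // pair_mod //.
  case: H => [[h1 es <- ->]|[h1 es ek]|[ek es hl]].
  - by rewrite h1 !eqxx.
  - by rewrite ifN ?ifT ?h1 //; lia.
  - by rewrite !ifN ?hl; lia.
move=> k k' kk hk hk'; have [v [c [s [-> hv hc H]]]] := gE k hk.
have [v' [c' [s' [-> hv' hc' H']]]] := gE k' hk' => /(cE _ _ _ _ _ _ hc hc') [ev ec es].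
subst v' c' s'; rewrite /=.
case: H => [[h1 e1 e2 e3]|[h1 e1 e2]|[e2 e1 _]]; case: H' => [[h1' e1' e2' e3']|[h1' e1' e2']|[e2' e1' _]];
  try (by move: e1'; rewrite e1; case: (a v)); try lia.
(* Two times of the first stretch remain; the cyclic shift of the copies is injective, so a common
   vehicle makes them equal. *)
have E : k %% ncl = k' %% ncl.
  by move: e3'; rewrite e3; case: (s) => // /modS_inj; apply; rewrite ltn_pmod.
by have := divn_eq k ncl; have := divn_eq k' ncl; rewrite e2 e2' E; lia.
Qed.

Lemma filling_sat : (exists g, slot_filling cnf_data g) -> sat.
Proof.
case=> g [h1 h2]; have B1 := ncl_le.
have pos k : nth false (d_p cnf_data) k -> cnf_av (g k) k /\ g k < B * 2.
  move=> hk; have [] := h1 k hk; rewrite size_mkseq => hg; rewrite nth_cnf_av //.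
  by move: hk; rewrite nth_cnf_p => /andP[].
(* [m v c] is the sign of the literal spent on copy [c] of [v], so the truth value of the copy is
   its negation. *)
pose M v c := g (B * 2 + (v * ncl + c)); pose m v c := odd (M v c).
have idx v c : v < nv -> c < ncl -> v * ncl + c < B.
  by move=> hv hc; rewrite /B; have := leq_mul hv (leqnn ncl); nia.
have inM v c : v < nv -> c < ncl -> nth false (d_p cnf_data) (B * 2 + (v * ncl + c)).
  by move=> hv hc; rewrite nth_cnf_p /cnf_p; have := idx v c hv hc; lia.
have ME v c : v < nv -> c < ncl -> M v c = code v c (m v c).
  move=> hv hc; have [+ _] := pos _ (inM v c hv hc); rewrite -/(M v c) /cnf_av.
  have := idx v c hv hc => hi; rewrite ifN; last by lia.
  rewrite ifT; last by lia.
  rewrite addKn => /andP[_ /eqP e]; rewrite /code e /m -modn2; exact: divn_eq.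
have clash v c k : v < nv -> c < ncl -> nth false (d_p cnf_data) k ->
    k < B * 2 + (v * ncl + c) <= k + B * 3 \/ B * 2 + (v * ncl + c) < k <= B * 5 -> g k <> M v c.
  move=> hv hc hk hd E; have := idx v c hv hc => hi.
  case: hd => /andP[d1 d2].
    by have := h2 _ _ d1 hk (inM v c hv hc) E; rewrite /=; lia.
  have := h2 _ _ d1 (inM v c hv hc) hk (esym E); rewrite /=; lia.
have step v c : v < nv -> c < ncl -> ~~ m v c -> ~~ m v (c.+1 %% ncl).
  move=> hv hc hm; set k := v * ncl + c.
  have hk : k < B by apply: idx.
  have pk : nth false (d_p cnf_data) k by rewrite nth_cnf_p /cnf_p; lia.
  have hc' : c.+1 %% ncl < ncl by rewrite ltn_pmod.
  have [+ _] := pos _ pk; rewrite /cnf_av hk /k pair_div // pair_mod // => /andP[/eqP ev /eqP ec].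
  have gE : g k = code v (g k %/ 2 %% ncl) (odd (g k)).
    rewrite /code {1}ev -divn_eq -modn2; exact: divn_eq.
  apply/negP => hm'; case: ifP ec => ho ec; rewrite ec ho in gE.
    apply: (clash v (c.+1 %% ncl) k) => //; last by rewrite ME // hm'.
    by left; rewrite /k; lia.
  apply: (clash v c k) => //; last by rewrite ME // (negbTE hm).
  by left; rewrite /k; lia.
(* All copies agree with copy 0: [up] follows the chain from copy 0, and [down] continues it beyond
   the last copy back to copy 0. *)
have up v c : v < nv -> c < ncl -> ~~ m v 0 -> ~~ m v c.
  move=> hv; elim: c => // c IH hc h0; have := step v c hv (ltnW hc) (IH (ltnW hc) h0).
  by rewrite modn_small.
have down v c : v < nv -> c < ncl -> ~~ m v c -> ~~ m v 0.
  move=> hv; move E: (ncl - c) => n; elim: n c E => [|n IH] c E hc hm; first by lia.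
  have := step v c hv hc hm; case: (ltngtP c.+1 ncl) hc => // [h|->] _; last by rewrite modnn.
  by rewrite modn_small // => /IH; apply => //; lia.
exists (fun v => ~~ m v 0) => c hc; set k := B * 4 + c.
have pk : nth false (d_p cnf_data) k by rewrite nth_cnf_p /cnf_p /k; lia.
have [+ hg] := pos _ pk; rewrite /cnf_av !ifN; [|rewrite /k; lia..].
rewrite /k addKn -/k; set v := g k %/ 2 %/ ncl => /andP[/andP[_ /eqP ec] hl].
have hv : v < nv by rewrite /v ltn_divLR // ltn_divLR //.
exists v => //; rewrite ec in hl.
have gE : g k = code v c (odd (g k)).
  by rewrite /code -{1}ec -divn_eq -modn2 -divn_eq.
have ne : m v c <> odd (g k).
  move=> E; apply: (clash v c k) => //; last by rewrite ME // E.
  by right; have := idx v c hv hc; rewrite /k; lia.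
suff -> : ~~ m v 0 = odd (g k) by [].
case E: (odd _) ne => ne; first by apply: (down v c) => //; case: (m v c) ne.
by apply: negbTE; apply/negP => h; have := up v c hv hc h; case: (m v c) ne.
Qed.

Lemma cnf_decision : ev_decision (of_data cnf_data) ((d_K cnf_data)%:R)%R <-> sat.
Proof. by rewrite (decisionP cnf_K); split; [apply: filling_sat | apply: sat_filling]. Qed.

End CNF.

(** * The computation tableau *)

Definition sym_code (a : Sym) : bool * bool :=
  match a with Zs => (false, false) | Os => (false, true) | Ss => (true, false) | Ts => (true, true) end.
Definition sym_decode (c : bool * bool) : Sym :=
  match c with (false, false) => Zs | (false, true) => Os | (true, false) => Ss | (true, true) => Ts end.
Lemma sym_codeK : cancel sym_code sym_decode. Proof. by case. Qed.

HB.instance Definition _ := Equality.copy Sym (can_type sym_codeK).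
HB.instance Definition _ := Choice.copy Sym (can_type sym_codeK).
HB.instance Definition _ := Countable.copy Sym (can_type sym_codeK).
HB.instance Definition _ : isFinite Sym := CanIsFinite sym_codeK.

Lemma is_symE a s : is_sym a s = (s == Some a).
Proof. by case: a; case: s => [[]|]. Qed.

Lemma nth_pairing x w i : nth None (map Some (pairing x w)) i =
  if i < size x * 2 then if odd i then nth None (map Some x) (i %/ 2) else Some Zs
  else if i == size x * 2 then Some Os else nth None (map Some w) (i - (size x * 2).+1).
Proof.
rewrite /pairing; elim: x i => [|a x IH] i /=; first by case: i => //= i; rewrite subSS subn0.
case: i => [|[|i]] //=; rewrite IH mulSn !addSn add0n !ltnS !eqSS !subSS negbK.
by rewrite (_ : i.+2 = 1 * 2 + i) ?divnMDl //; case: ltnP.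
Qed.

Section CookLevin.
Variables (V : TM) (N : nat) (x : seq Sym).
Notation Q := (tm_Q V).
Notation n := (size x).
Notation q0 := (@tm_start V).

(* Tableau of a run with the head kept at column [tW]: columns 1 .. tP - 1 hold the tape, read
   relatively to the head, and column 0 holds the state.  The time-[t] cells whose content is
   determined by the row at time 0 are those with [t < p] and [p + t < tP]. *)
Definition tW := N.+1.
Definition tP := (N + n).+1 * 2.
Definition cell_val : finType := (option Sym + Q)%type.

(* A clause is [inl (q, a, b)] for a transition from state [q] reading [a] and applied next to a
   cell containing [b]; [inr (inl q)] forbids the final state [q]; [inr (inr true)] fixes the first
   row except for the witness, which is only constrained by [inr (inr false)] to be blank from its
   first blank on. *)
Definition clause_kind : finType := (Q * option Sym * option Sym + (Q + bool))%type.

Definition next (q : Q) (a : option Sym) : Q * option Sym * move :=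
  if @tm_halt V q then (q, a, MStay) else @tm_delta V q a.

(** After the move, column [p] shows what was in column [p + mshift mv - 1]; the offset by one keeps
    the shift in [nat]. *)
Definition mshift (mv : move) : nat := match mv with MLeft => 0 | MStay => 1 | MRight => 2 end.

Definition cell (tp : tape) (p : nat) : option Sym :=
  let: (l, h, r) := tp in
  if p < tW then nth None l (tW - p.+1) else nth None (h :: r) (p - tW).

Definition allowed (p : nat) (s : cell_val) : bool :=
  match s with
  | inr q => (p == 0) && (q == q0)
  | inl a => (0 < p) &&
      if p < tW then a == None
      else if p - tW < n * 2 then
        if odd (p - tW) then a == nth None (map Some x) ((p - tW) %/ 2) else a == Some Zs
      else if p - tW == n * 2 then a == Some Os else true
  end.

(** Membership of a literal in a clause. In a transition clause the negative literals are the
    premises and the positive one is the new content of column [p]. A kind that does not apply at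
    [(t, p)] gives a clause with all literals, so that clauses can be indexed by a full product. *)
Definition tlit (t' p' : nat) (s : cell_val) (sg : bool) (t p : nat) (k : clause_kind) : bool :=
  match k with
  | inl (q, a, b) =>
      if (t < N) && ((p == 0) || ((t.+1 < p) && (p + t.+1 < tP))) then
        if sg then (t' == t.+1) && (p' == p) &&
          if p == 0 then s == inr (next q a).1.1
          else if p + mshift (next q a).2 == tW.+1 then s == inl (next q a).1.2 else s == inl b
        else (t' == t) &&
          [|| (p' == 0) && (s == inr q), (p' == tW) && (s == inl a)
            | [&& 0 < p, p'.+1 == p + mshift (next q a).2 & s == inl b]]
      else true
  | inr (inl q) =>
      if [&& t == N, p == 0 & ~~ (@tm_halt V q && @tm_acc V q)] then
        [&& ~~ sg, t' == N, p' == 0 & s == inr q]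
      else true
  | inr (inr true) => if t == 0 then [&& sg, t' == 0, p' == p & allowed p s] else true
  | inr (inr false) =>
      if [&& t == 0, tW + n * 2 < p & p.+1 < tP] then
        [&& t' == 0, p' == p + sg & s == inl None]
      else true
  end.

Definition tableau (A : nat -> nat -> cell_val -> bool) : Prop :=
  forall t p k, t <= N -> p < tP ->
  exists t' p' s, [/\ t' <= N, p' < tP & tlit t' p' s (A t' p' s) t p k].

Lemma stepE q l h r :
  @step V (q, (l, h, r)) = ((next q h).1.1, move_tape (next q h).2 (l, (next q h).1.2, r)).
Proof. by rewrite /step /next; case: ifP => // _; case: (tm_delta _ _) => [[]]. Qed.

Lemma cellE tp z f p : tape_at tp z f -> cell tp p = f (z + p%:Z - tW%:Z)%R.
Proof.
case: tp => [[l h] r] [Hh Hl Hr]; rewrite /cell; case: ltnP => hp.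
  by rewrite -Hl; congr f; lia.
case E: (p - tW) => [|i] /=; first by rewrite -Hh; congr f; lia.
by rewrite -Hr; congr f; lia.
Qed.

Lemma cell_move l h r w mv p : 0 < p ->
  cell (move_tape mv (l, w, r)) p =
  if p + mshift mv == tW.+1 then w else cell (l, h, r) (p + mshift mv).-1.
Proof.
move=> p0; pose f (z : int) := match z with
  | Posz 0 => h | Posz i.+1 => nth None r i | Negz i => nth None l i end.
have H : tape_at (l, h, r) 0%R f.
  split=> // i.
  by rewrite (_ : 0 - 1 - i%:Z = Negz i)%R //; lia.
rewrite (cellE _ H) (cellE _ (tape_at_move w mv H)) /fset.
rewrite (_ : (_ == 0%R) = (p + mshift mv == tW.+1)); last by case: mv => /=; lia.
by case: eqP => // ne; congr f; case: mv ne => /=; lia.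
Qed.

Lemma tlit_row0 A : tableau A -> forall p, p < tP -> exists2 s, A 0 p s & allowed p s.
Proof.
move=> H p hp; have [t' [p' [s [_ _]]]] := H 0 p (inr (inr true)) (leq0n _) hp.
by move=> /= /and4P[Ha /eqP et /eqP ep al]; exists s => //; rewrite -et -ep.
Qed.

Lemma tlit_blank A j : tableau A -> tW + n * 2 < j -> j.+1 < tP ->
  A 0 j (inl None) -> A 0 j.+1 (inl None).
Proof.
move=> H h1 h2 h3; have [t' [p' [s [_ _]]]] := H 0 j (inr (inr false)) (leq0n _) (ltnW h2).
rewrite /tlit eqxx h1 h2 /= => /and3P[/eqP -> /eqP ep /eqP es]; subst s.
case E: (A _ _ _) ep => ep; first by rewrite -addn1 -ep E.
by rewrite addn0 in ep; rewrite ep h3 in E.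
Qed.

Lemma tlit_step A t p q a b : tableau A -> t < N -> p < tP ->
  (p == 0) || ((t.+1 < p) && (p + t.+1 < tP)) ->
  A t 0 (inr q) -> A t tW (inl a) -> (0 < p -> A t (p + mshift (next q a).2).-1 (inl b)) ->
  A t.+1 p (if p == 0 then inr (next q a).1.1
            else if p + mshift (next q a).2 == tW.+1 then inl (next q a).1.2 else inl b).
Proof.
move=> H ht hp act h1 h2 h3; have [t' [p' [s [_ _]]]] := H t p (inl (q, a, b)) (ltnW ht) hp.
rewrite /tlit ht act /=; case E: (A t' p' s).
  move=> /andP[/andP[/eqP et /eqP ep]] hs; rewrite -et -ep.
  by move: hs; rewrite -ep; case: eqP => _; [|case: eqP => _] => /eqP <-.
move=> /andP[/eqP et] /or3P[/andP[/eqP ep /eqP es]|/andP[/eqP ep /eqP es]|/and3P[p0 /eqP ep /eqP es]].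
- by rewrite et ep es h1 in E.
- by rewrite et ep es h2 in E.
- by move: (h3 p0); rewrite -ep -es -et E.
Qed.

Lemma tlit_final A q : tableau A -> A N 0 (inr q) -> @tm_halt V q && @tm_acc V q.
Proof.
move=> H h; have [t' [p' [s [_ _]]]] := H N 0 (inr (inl q)) (leqnn _) isT.
rewrite /tlit !eqxx /=; case: (_ && _) => //= /and4P[hA /eqP et /eqP ep /eqP es].
by rewrite et ep es h in hA.
Qed.

Notation cfg w t := (run V t (pairing x w)).

Lemma runS t y : run V t.+1 y = step (run V t y).
Proof. by []. Qed.

Lemma cell_run w t p : 0 < p ->
  let: (q, a) := ((cfg w t).1, cell (cfg w t).2 tW) in
  cell (cfg w t.+1).2 p =
  if p + mshift (next q a).2 == tW.+1 then (next q a).1.2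
  else cell (cfg w t).2 (p + mshift (next q a).2).-1.
Proof.
move=> p0; rewrite runS; case: (cfg w t) => q [[l h] r]; rewrite stepE /=.
by rewrite ltnn subnn /= (cell_move l h r).
Qed.

Lemma state_run w t :
  (cfg w t.+1).1 = (next (cfg w t).1 (cell (cfg w t).2 tW)).1.1.
Proof. by rewrite runS; case: (cfg w t) => q [[l h] r]; rewrite stepE /= ltnn subnn. Qed.

Lemma cell_init w p :
  cell (cfg w 0).2 p = if p < tW then None else nth None (map Some (pairing x w)) (p - tW).
Proof.
rewrite /run /=; case: (pairing x w) => [|a y] /=; case: ltnP => h; rewrite ?nth_nil //.
by case: (p - tW) => //= i; rewrite nth_nil.
Qed.

Lemma tableau_accepts A : tableau A ->
  exists w k, [/\ size w <= N, k <= N & accepting (cfg w k)].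
Proof.
move=> H; pose o := tW + (n * 2).+1.
(* The witness ends at the first cell that may be blank. Each earlier cell has some symbol among its
   values, and any of them will do. *)
pose j0 := find (fun j => A 0 (o + j) (inl None)) (iota 0 N).
have j0N : j0 <= N by rewrite -[X in _ <= X](size_iota 0 N) find_size.
pose sy j := odflt Zs [pick a | A 0 (o + j) (inl (Some a))].
pose w := mkseq sy j0; exists w, N.
(* [tP] leaves exactly [N] columns for the witness after the part of the pairing that encodes
   [x]. *)
have oP : o + N = tP by rewrite /o /tW /tP; lia.
have blank j : j < N -> j0 <= j -> A 0 (o + j) (inl None).
  move=> jN; elim: j jN => [|j IH] jN; rewrite leq_eqVlt => /orP[/eqP e|h]; try by [].
  - have hs : has (fun j => A 0 (o + j) (inl None)) (iota 0 N) by rewrite has_find size_iota -/j0 e.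
    by have := nth_find 0 hs; rewrite -/j0 e nth_iota.
  - have hs : has (fun j => A 0 (o + j) (inl None)) (iota 0 N) by rewrite has_find size_iota -/j0 e.
    by have := nth_find 0 hs; rewrite -/j0 e nth_iota.
  by rewrite addnS; apply: tlit_blank => //; [rewrite /o; lia | lia | apply: IH; lia].
have row0 p : 0 < p -> p < tP -> A 0 p (inl (cell (cfg w 0).2 p)).
  move=> p0 hp; have [s As] := tlit_row0 H hp; rewrite cell_init.
  case: s As => [a|q] As /=; last by rewrite eqn0Ngt p0.
  rewrite p0 /=; case: ltnP => h1; first by move/eqP => <-.
  rewrite nth_pairing; case: ltnP => h2; first by case: odd => /eqP <-.
  case: eqP => h3; first by move/eqP => <-.
  move=> _; set j := _ - _.
  have ej : p = o + j by rewrite /o /j; lia.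
  have jN : j < N by move: oP hp; rewrite ej; lia.
  case: (ltnP j j0) => hj; last first.
    rewrite nth_default; first by rewrite ej; apply: blank.
    by rewrite size_map size_mkseq.
  move: As; rewrite ej => As.
  rewrite (nth_map Zs) ?size_mkseq // nth_mkseq // /sy.
  case: pickP => [b //|no]; case: a As => [b|] As; first by have := no b; rewrite As.
  have := before_find 0 hj; by rewrite nth_iota // add0n As.
have rows t : t <= N -> A t 0 (inr (cfg w t).1) /\ forall p, t < p -> p + t < tP -> A t p (inl (cell (cfg w t).2 p)).
  elim: t => [|t IH] ht.
    split=> [|p p0 hp]; last by apply: row0 => //; lia.
    have [s As] := tlit_row0 H (p := 0) isT.
    by case: s As => [a|q] //= As /eqP <-.
  have [IH1 IH2] := IH (ltnW ht).
  have hW : A t tW (inl (cell (cfg w t).2 tW)) by apply: IH2; rewrite /tP /tW; lia.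
  split=> [|p h1 h2].
    (* The state column has no neighbour premise, so [None] is an arbitrary choice. *)
    by rewrite state_run; apply: (@tlit_step A t 0 _ _ None H ht isT isT IH1 hW).
  rewrite cell_run; last by lia.
  set q := (cfg w t).1; set a := cell _ tW; set b := cell _ (_).-1.
  have := @tlit_step A t p q a b H ht; rewrite (_ : (p == 0) = false); last by lia.
  rewrite h1 h2 (fun_if inl) => G; apply: G => //; first by lia.
  by move=> p0; apply: IH2; case: (next q a).2 => /=; lia.
split=> //; first by rewrite size_mkseq.
have [hN _] := rows N (leqnn _); exact: tlit_final H hN.
Qed.

Lemma accepts_tableau w k : size w <= N -> k <= N -> accepting (cfg w k) -> exists A, tableau A.
Proof.
move=> hw hk hacc.
(* Halted configurations are fixed by [step], so acceptance persists until time [N]. *)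
have hN : accepting (cfg w N).
  rewrite -(subnK hk) /run iterD -/(cfg w k).
  by elim: (N - k) => // m IH; rewrite iterS; move: IH; rewrite /accepting /step;
    case: (iter _ _ _) => q [[l h] r] /= /[dup] ? /andP[-> _].
pose A t p (s : cell_val) := match s with
  | inl a => (0 < p) && (cell (cfg w t).2 p == a)
  | inr q => (p == 0) && ((cfg w t).1 == q) end.
exists A => t p [[[q a] b]|[q|[]]] ht hp.
- have [/[dup] c /andP[tN act]|c] :=
    boolP ((t < N) && ((p == 0) || ((t.+1 < p) && (p + t.+1 < tP)))); last first.
    by exists 0, 0, (inr q0); rewrite /tlit (negbTE c).
  rewrite /tlit c.
  case hq: (A t 0 (inr q)); last by exists t, 0, (inr q); rewrite hq !eqxx.
  have WP : tW < tP by rewrite /tW /tP; lia.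
  case ha: (A t tW (inl a)); last by exists t, tW, (inl a); rewrite ha !eqxx.
  case: (posnP p) act => [p0|p0] act.
    exists t.+1, 0, (inr (next q a).1.1); rewrite p0 /=; split=> //.
    by move: hq ha; rewrite /= => /eqP <- /eqP <-; rewrite state_run !eqxx.
  have {act} /andP[act1 act2] : (t.+1 < p) && (p + t.+1 < tP) by [].
  set p1 := (p + mshift (next q a).2).-1.
  have ep : p1.+1 = p + mshift (next q a).2 by rewrite /p1; case: (next q a).2 => /=; lia.
  have hp1 : p1 < tP by rewrite -ltnS ep; case: (next q a).2 => /=; lia.
  case hb: (A t p1 (inl b)); last first.
    by exists t, p1, (inl b); split=> //; rewrite hb ep !eqxx !orbT.
  exists t.+1, p, (if p + mshift (next q a).2 == tW.+1 then inl (next q a).1.2 else inl b).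
  split=> //; rewrite !eqxx /=.
  suff -> : A t.+1 p (if p + mshift (next q a).2 == tW.+1 then inl (next q a).1.2 else inl b).
    by case: ifP => h; rewrite h.
  move: hq ha hb => /andP[_ /eqP eq] /andP[_ /eqP ea] /andP[_ /eqP eb].
  have := @cell_run w t p p0; rewrite eq ea -/p1 eb => E.
  by move: E; case: ifP => _ E; rewrite /A p0 E eqxx.
- have [c|c] := boolP [&& t == N, p == 0 & ~~ (@tm_halt V q && @tm_acc V q)]; last first.
    by exists 0, 0, (inr q0); rewrite /tlit (negbTE c).
  have /and3P[_ _ hq] := c; exists N, 0, (inr q); rewrite /tlit c !eqxx /=; split=> //; rewrite andbT.
  by apply: contra hq => /eqP <-.
- have [t0|t0] := eqVneq t 0; last by exists 0, 0, (inr q0); rewrite /tlit (negbTE t0).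
  case: (posnP p) => [p0|p0].
    by exists 0, 0, (inr q0); rewrite /tlit t0 p0 /= !eqxx.
  exists 0, p, (inl (cell (cfg w 0).2 p)); split=> //.
  rewrite /tlit t0 /A p0 !eqxx /= p0 cell_init; case: (p < tW) => //.
  rewrite nth_pairing; case: (_ < n * 2); first by case: (odd _); rewrite eqxx.
  by case: (_ == n * 2); rewrite ?eqxx.
- have [c|c] := boolP [&& t == 0, tW + n * 2 < p & p.+1 < tP]; last first.
    by exists 0, 0, (inr q0); rewrite /tlit (negbTE c).
  have /and3P[_ h1 h2] := c; rewrite /tlit c.
  case h: (A 0 p (inl None)); last by exists 0, p, (inl None); rewrite h addn0 !eqxx.
  exists 0, p.+1, (inl None); split=> //; suff -> : A 0 p.+1 (inl None) by rewrite addn1 !eqxx.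
  move: h; rewrite /= => /andP[_]; rewrite !cell_init !ifN; try lia.
  rewrite !nth_pairing !ifN; try lia.
  rewrite (_ : p.+1 - tW - (n * 2).+1 = (p - tW - (n * 2).+1).+1); last by lia.
  move: (p - tW - _) => i /eqP h; apply/eqP.
  case: (ltnP i (size w)) h => hi; first by rewrite (nth_map Zs).
  by rewrite !nth_default // size_map // leqW.
Qed.

End CookLevin.

(** * The reduction *)

Section Flattening.
Variables (V : TM) (N : nat) (x : seq Sym).
Notation S := #|cell_val V|.
Notation R := #|clause_kind V|.
Notation P := (tP N x).

Definition cell0 : cell_val V := inl None.
Definition kind0 : clause_kind V := inr (inr true).

Definition nvars := N.+1 * P * S.
Definition nclauses := N.+1 * P * R.

Definition flat_lit (u : nat) (sg : bool) (c : nat) : bool :=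
  tlit N x (u %/ S %/ P) (u %/ S %% P) (nth cell0 (enum (cell_val V)) (u %% S)) sg
       (c %/ R %/ P) (c %/ R %% P) (nth kind0 (enum (clause_kind V)) (c %% R)).

Lemma S_gt0 : 0 < S. Proof. by apply/card_gt0P; exists cell0. Qed.
Lemma R_gt0 : 0 < R. Proof. by apply/card_gt0P; exists kind0. Qed.
Lemma nvars_gt0 : 0 < nvars. Proof. by rewrite /nvars !muln_gt0 S_gt0. Qed.
Lemma nclauses_gt0 : 0 < nclauses. Proof. by rewrite /nclauses !muln_gt0 R_gt0. Qed.

Definition flat (I : finType) (t p : nat) (i : I) := (t * P + p) * #|I| + index i (enum I).

Lemma flatK (I : finType) (i0 : I) t p i : p < P ->
  [/\ flat t p i %/ #|I| %/ P = t, flat t p i %/ #|I| %% P = p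
    & nth i0 (enum I) (flat t p i %% #|I|) = i].
Proof.
move=> hp; have hi : index i (enum I) < #|I| by rewrite cardE index_mem mem_enum.
have I0 : 0 < #|I| by apply: leq_ltn_trans hi.
rewrite /flat divnMDl // modnMDl (divn_small hi) (modn_small hi) addn0 divnMDl // divn_small //.
by rewrite addn0 modnMDl modn_small // nth_index // mem_enum.
Qed.

Lemma flat_lt (I : finType) t p (i : I) : t <= N -> p < P -> flat t p i < N.+1 * P * #|I|.
Proof.
move=> ht hp; have hi : index i (enum I) < #|I| by rewrite cardE index_mem mem_enum.
have h : t * P + p < N.+1 * P by have := leq_mul ht (leqnn P); rewrite mulSn; lia.
by rewrite /flat; have := leq_mul h (leqnn #|I|); rewrite mulSn; lia.
Qed.

Lemma unflat (I : finType) (i0 : I) u : u < N.+1 * P * #|I| ->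
  [/\ u %/ #|I| %/ P <= N, u %/ #|I| %% P < P
    & flat (u %/ #|I| %/ P) (u %/ #|I| %% P) (nth i0 (enum I) (u %% #|I|)) = u].
Proof.
move=> hu; have I0 : 0 < #|I| by case: (#|I|) hu => //; rewrite muln0.
split; [by rewrite -ltnS !ltn_divLR | by rewrite ltn_pmod |].
by rewrite /flat index_uniq ?enum_uniq -?divn_eq // -cardE ltn_pmod.
Qed.

Lemma sat_tableau : sat nvars nclauses flat_lit <-> exists A, @tableau V N x A.
Proof.
split=> [[a H]|[A H]].
  exists (fun t p s => a (flat t p s)) => t p k ht hp.
  have [et ep ek] := flatK kind0 t k hp.
  have [v hv L] := H _ (flat_lt k ht hp); have [h1 h2 ev] := unflat cell0 hv.
  exists (v %/ S %/ P), (v %/ S %% P), (nth cell0 (enum (cell_val V)) (v %% S)).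
  by move: L; rewrite ev /flat_lit et ep ek.
exists (fun u => A (u %/ S %/ P) (u %/ S %% P) (nth cell0 (enum (cell_val V)) (u %% S))) => c hc.
have [h1 h2 _] := unflat kind0 hc.
have [t' [p' [s [ht hp L]]]] := H _ _ (nth kind0 (enum (clause_kind V)) (c %% R)) h1 h2.
exists (flat t' p' s); first exact: flat_lt.
by have [et ep es] := flatK cell0 t' s hp; rewrite /flat_lit et ep es.
Qed.

End Flattening.

Lemma ex_odd f : exprable f -> exprable (fun y E => odd (f y E) : nat).
Proof. by move=> hf; apply: ex_ext (ex_mod hf (ex_const 2)) _ => y E; rewrite modn2. Qed.

Lemma ex_nth a f : exprable f -> exprable (fun y E => a == nth None (map Some y) (f y E) : nat).
Proof.
move=> hf; case: a => [a|].
  by apply: ex_ext (ex_sym a hf) _ => y E; rewrite is_symE eq_sym.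
apply: ex_ext (ex_leq ex_len hf) _ => y E; case: ltnP => h; first by rewrite (nth_map Zs).
by rewrite nth_default ?size_map.
Qed.

Ltac ex_step :=
  match goal with
  | |- exprable (fun x E => nat_of_bool (@?a x E && @?b x E)) => refine (@ex_and a b _ _)
  | |- exprable (fun x E => nat_of_bool (@?a x E || @?b x E)) => refine (@ex_or a b _ _)
  | |- exprable (fun x E => nat_of_bool (~~ @?a x E)) => refine (@ex_neg a _)
  | |- exprable (fun x E => nat_of_bool (if _ then _ else _)) => apply: ex_ifb
  | |- exprable (fun x E => nat_of_bool (odd (@?a x E))) => refine (@ex_odd a _)
  | |- exprable (fun x E => nat_of_bool (@?a x E <= @?b x E)) => refine (@ex_leq a b _ _)
  | |- exprable (fun x E => nat_of_bool (?a == nth None (map Some x) (@?b x E))) =>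
      refine (@ex_nth a b _)
  | |- exprable (fun x E => nat_of_bool (@eq_op _ (@?a x E) (@?b x E))) => refine (@ex_eq a b _ _)
  | |- exprable (fun x E => if _ then _ else _) => apply: ex_if
  | |- exprable (fun x E => (@?a x E).+1) => refine (@ex_succ a _)
  | |- exprable (fun x E => @?a x E + @?b x E) => refine (@ex_add a b _ _)
  | |- exprable (fun x E => @?a x E - @?b x E) => refine (@ex_sub a b _ _)
  | |- exprable (fun x E => @?a x E * @?b x E) => refine (@ex_mul a b _ _)
  | |- exprable (fun x E => @?a x E %/ @?b x E) => refine (@ex_div a b _ _)
  | |- exprable (fun x E => @?a x E %% @?b x E) => refine (@ex_mod a b _ _)
  end.
Ltac ex_solve :=
  cbv beta; repeat (first [exact: ex_const | exact: ex_len | exact: ex_var | assumption | ex_step];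
                    cbv beta).

(** Kind, sign and cell value are fixed here, so the transition table of [V] contributes constants
    only. What remains is arithmetic on times and columns and lookups in the input. *)
Lemma ex_tlit V N f' g' f g s sg k : exprable (fun y _ => N y) ->
  exprable f' -> exprable g' -> exprable f -> exprable g ->
  exprable (fun y E => @tlit V (N y) y (f' y E) (g' y E) s sg (f y E) (g y E) k : nat).
Proof.
move=> hN hf' hg' hf hg.
by case: k => [[[q a] b]|[q|[]]]; case: sg; case: s => [c|q']; rewrite /tlit /allowed /tP /tW; ex_solve.
Qed.

Lemma ex_flat_lit V N sg f g : exprable (fun y _ => N y) -> exprable f -> exprable g ->
  exprable (fun y E => flat_lit V (N y) y (f y E) sg (g y E) : nat).
Proof.
move=> hN hf hg; rewrite /flat_lit.
have ht (h : seq Sym -> env -> nat) m : exprable h ->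
    exprable (fun y E => h y E %/ m %/ tP (N y) y) /\ exprable (fun y E => h y E %/ m %% tP (N y) y).
  by move=> hh; split; rewrite /tP; ex_solve.
have [f1 f2] := ht f #|cell_val V| hf; have [g1 g2] := ht g #|clause_kind V| hg.
apply: (@ex_tableb _ (cell0 V) _ (fun s y E => tlit (N y) y _ _ s sg _ _ _)) => [|s]; first by ex_solve.
apply: (@ex_tableb _ (kind0 V) _ (fun k y E => tlit (N y) y _ _ s sg _ _ k)) => [|k]; first by ex_solve.
exact: ex_tlit.
Qed.

Lemma ex_cnf_av (nv ncl : seq Sym -> nat) (lit : seq Sym -> nat -> bool -> nat -> bool) f g :
  exprable (fun y _ => nv y) -> exprable (fun y _ => ncl y) -> exprable f -> exprable g ->
  (forall sg f g, exprable f -> exprable g -> exprable (fun y E => lit y (f y E) sg (g y E) : nat)) ->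
  exprable (fun y E => cnf_av (nv y) (ncl y) (lit y) (f y E) (g y E) : nat).
Proof.
move=> hnv hncl hf hg hlit.
(* The sign is the parity of a computed value, whereas [hlit] takes a fixed sign: hence a case
   distinction on the parity. *)
pose l y E sg := lit y (f y E %/ 2 %/ ncl y) sg (f y E %/ 2 %% ncl y).
have hl : exprable (fun y E => (if odd (f y E) then l y E true else l y E false) : nat).
  by apply: ex_ifb; [exact: ex_odd | apply: hlit; ex_solve | apply: hlit; ex_solve].
have hl' : exprable (fun y E => lit y (f y E %/ 2 %/ ncl y) (odd (f y E)) (f y E %/ 2 %% ncl y) : nat).
  by apply: ex_ext hl _ => y E; rewrite /l; case: odd.
by rewrite /cnf_av; ex_solve.
Qed.

Lemma ev_lang_enc d : data_wf d ->
  EV_restricted_lang (enc_ev d) <-> ev_decision (of_data d) ((d_K d)%:R)%R.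
Proof.
move=> hd; split=> [[d' [_ /enc_ev_inj -> _]] //|h].
exists d; split=> //; split=> //; first by exists (d_C d).
by move=> j t _ _ /=; case: (nth _ _ _); [right | left].
Qed.

(* Strong NP-hardness of the EV valet problem: the decision problem is
   NP-hard already on instances with a common charging time, 0/1 rewards
   and a single station, with all numbers written in unary. *)
Theorem theorem1 : NP_hard EV_restricted_lang.
Proof.
move=> L [V [c [e HL]]]; pose N (x : seq Sym) := poly c e (size x).
pose nv x := nvars V (N x) x; pose ncl x := nclauses V (N x) x.
pose lit x := flat_lit V (N x) x.
(* The polynomial bound is an expression because its coefficient and exponent depend on [L]
   alone. *)
have hN : exprable (fun x _ => N x).
  by apply: ex_mul (ex_const c) _; apply: ex_pow; apply: ex_succ; apply: ex_len.
have hnv : exprable (fun x _ => nv x) by rewrite /nv /nvars /tP; ex_solve.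
have hncl : exprable (fun x _ => ncl x) by rewrite /ncl /nclauses /tP; ex_solve.
have hp : exprable (fun x E => cnf_p (nv x) (ncl x) (E 1) : nat) by rewrite /cnf_p; ex_solve.
have hav : exprable (fun x E => cnf_av (nv x) (ncl x) (lit x) (E 1) (E 3) : nat).
  by apply: ex_cnf_av => //; try exact: ex_var; move=> sg f g hf hg; apply: ex_flat_lit.
have [M [c1 [e1 HM]]] := @table_data_poly_time
  (fun x => nv x * ncl x * 3) (fun x => nv x * ncl x * 2 + ncl x) (fun x => nv x * ncl x * 4 + ncl x)
  (fun x => nv x * ncl x * 2) (fun x => cnf_p (nv x) (ncl x))
  (fun x => cnf_av (nv x) (ncl x) (lit x))
  ltac:(ex_solve) ltac:(ex_solve) ltac:(ex_solve) ltac:(ex_solve) hp hav.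
exists M, c1, e1 => x; have [k [h1 h2 h3]] := HM x; exists k; split=> //.
rewrite h3 ev_lang_enc; last exact: table_data_wf.
rewrite (cnf_decision _ (nvars_gt0 _ _ _) (nclauses_gt0 _ _ _)) sat_tableau.
have [_ HLx] := HL x; rewrite HLx; split.
  by move=> [w [m [hw hm acc]]]; apply: accepts_tableau hw hm acc.
by move=> [A /tableau_accepts [w [m [hw hm acc]]]]; exists w, m.
Qed.
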